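(* (Lagrange Loop Theorem.) Apply the Smallest Vector Algorithm to $\mathbf X={}^{T}(x_0,x_1,x_2)$ and let $\mathbf X^{(s)}$ be its cofactor vectors. First part: Let $\rho$ be a real root of an irreducible polynomial $P(r)=r^3-ar^2-br-c$ with $a,b,c\in\mathbb Q$. Let $\mathbf X={}^{T}(x_0,x_1,x_2)$ be a rationally independent triple of real numbers in $\mathbb Q[\rho]$ with $0<x_0<x_1<x_2$. Then the algorithm ''makes a loop'': there exist integers $s\ge 0$ and $p>0$ and a real number $\lambda$ such that $\mathbf X^{(s+p)}=\lambda\mathbf X^{(s)}$. Equivalently, $\mathbf x^{(s+p)}=\mathbf x^{(s)}$, where $\mathbf x^{(s)}=\bigl(x_0^{(s)}/x_2^{(s)},\,x_1^{(s)}/x_2^{(s)}\bigr)$. Moreover: - $\lambda$ is an algebraic integer of degree $3$; - $\lambda$ is a unit; - $\mathbb Q[\rho]=\mathbb Q[\lambda]$; - $x_0/x_2$ and $x_1/x_2$ can be expressed as rational functions of $\lambda$ with rational coefficients. Second part (converse): Let $\mathbf X={}^{T}(x_0,x_1,x_2)$ be any rationally independent triple of real numbers with $0<x_0<x_1<x_2$. Suppose that $\mathbf X^{(s+p)}=\lambda\mathbf X^{(s)}$ for some $s\ge0$, some $p>0$ and some real $\lambda$. Then: - $\lambda$ is an algebraic integer of degree $3$ and a unit; - $x_0/x_2$ and $x_1/x_2$ can be expressed as rational functions of $\lambda$ with rational coefficients.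
   Context: Use the Euclidean norm and inner product $\bullet$ on $\mathbb R^3$. Let $\mathbf X={}^{T}(x_0,x_1,x_2)$ with $0<x_0<x_1<x_2$. Set $\mathbb D=\mathbb R\mathbf X$ and $\mathbb P=\mathbb D^{\perp}$. For $\mathbf h\in\mathbb R^3$, write $\mathbf h'$ for its orthogonal projection on $\mathbb P$ and $\mathbf h''$ for its orthogonal projection on $\mathbb D$. The Smallest Vector Algorithm (SVA) produces integer $3\times3$ matrices $\mathbf G^{(s)}=(\mathbf g_0^{(s)},\mathbf g_1^{(s)},\mathbf g_2^{(s)})$, given by their columns, as follows. - $\mathbf G^{(0)}=\mathbf I$. - Given $\mathbf G^{(s)}$ (superscripts omitted), let $\Delta_{\min}=\min(\|\mathbf g_1'-\mathbf g_0'\|,\|\mathbf g_2'-\mathbf g_1'\|,\|\mathbf g_2'-\mathbf g_0'\|)$. Define $(\mathbf f_0,\mathbf f_1,\mathbf f_2)$ by: - $(\mathbf g_0,\mathbf g_1-\mathbf g_0,\mathbf g_2)$ if $\Delta_{\min}=\|\mathbf g_1'-\mathbf g_0'\|$; - $(\mathbf g_0,\mathbf g_1,\mathbf g_2-\mathbf g_1)$ if $\Delta_{\min}=\|\mathbf g_2'-\mathbf g_1'\|$; - $(\mathbf g_0,\mathbf g_1,\mathbf g_2-\mathbf g_0)$ if $\Delta_{\min}=\|\mathbf g_2'-\mathbf g_0'\|$. - $\mathbf G^{(s+1)}$ is any permutation of the columns $\mathbf f_0,\mathbf f_1,\mathbf f_2$ such that $\|\mathbf g_0^{(s+1)\prime\prime}\|\le\|\mathbf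 g_1^{(s+1)\prime\prime}\|\le\|\mathbf g_2^{(s+1)\prime\prime}\|$. The cofactor vector is $\mathbf X^{(s)}={}^{T}(x_0^{(s)},x_1^{(s)},x_2^{(s)})=\|\mathbf X\|\,{}^{T}(\|\mathbf g_0^{(s)\prime\prime}\|,\|\mathbf g_1^{(s)\prime\prime}\|,\|\mathbf g_2^{(s)\prime\prime}\|)$. *)

(* Defs.v *)
From mathcomp Require Import all_boot all_order all_fingroup all_algebra.
From mathcomp Require Import all_classical reals.

Set Implicit Arguments.
Unset Strict Implicit.
Unset Printing Implicit Defensive.

Import Order.TTheory GRing.Theory Num.Theory.

Local Open Scope ring_scope.
Local Open Scope classical_set_scope.

Section Euclidean.
Variable R : realType.
Implicit Types u v X h : 'cV[R]_3.

Definition dot u v : R := \sum_i u i 0 * v i 0.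

(* The notation `| u | on matrices is the sup norm, hence this definition. *)
Definition enorm u : R := Num.sqrt (dot u u).

(* h'', the orthogonal projection of h on the line spanned by X. *)
Definition projD X h : 'cV[R]_3 := (dot h X / dot X X) *: X.

(* h', the orthogonal projection of h on the plane orthogonal to X. *)
Definition projP X h : 'cV[R]_3 := h - projD X h.

Lemma dotBl u v w : dot (u - v) w = dot u w - dot v w.
Proof.
by rewrite /dot -sumrB; apply: eq_bigr => i _; rewrite !mxE mulrBl.
Qed.

Lemma dotZl (a : R) u v : dot (a *: u) v = a * dot u v.
Proof.
by rewrite /dot mulr_sumr; apply: eq_bigr => i _; rewrite !mxE mulrA.
Qed.

Lemma dot_eq0 u : (dot u u == 0) = (u == 0).
Proof.
apply/idP/eqP => [/eqP u0|->]; last first.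
  by rewrite /dot big1 // => i _; rewrite mxE mul0r.
apply/colP => i; rewrite mxE; apply/eqP.
rewrite -sqrf_eq0 expr2; apply/eqP.
have H (j : 'I_3) : true -> 0 <= u j 0 * u j 0 by rewrite -expr2 sqr_ge0.
exact: (psumr_eq0P H u0 (i := i) isT).
Qed.

Lemma projP_orth X h : X != 0 -> dot (projP X h) X = 0.
Proof.
move=> X0; rewrite /projP dotBl /projD dotZl divfK ?subrr //.
by rewrite dot_eq0.
Qed.

End Euclidean.

Section SmallestVector.
Variable R : realType.
Implicit Types (X : 'cV[R]_3) (G F : 'M[int]_3).

Definition rcol G (i : 'I_3) : 'cV[R]_3 := map_mx intr (col i G).

Definition proj_dist X G (j i : 'I_3) : R :=
  enorm (projP X (rcol G j) - projP X (rcol G i)).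

Definition proj_dist_min X G : R :=
  Num.min (proj_dist X G 1 0) (Num.min (proj_dist X G 2 1) (proj_dist X G 2 0)).

(* G with its column g_j replaced by g_j - g_i. *)
Definition sub_col (j i : 'I_3) G : 'M[int]_3 :=
  \matrix_(k, l) (if l == j then G k j - G k i else G k l).

(* When the minimum is attained more than once, each of the corresponding
   subtractions is allowed. *)
Definition sva_subtract X G F : Prop :=
  [\/ proj_dist_min X G = proj_dist X G 1 0 /\ F = sub_col 1 0 G,
      proj_dist_min X G = proj_dist X G 2 1 /\ F = sub_col 2 1 G |
      proj_dist_min X G = proj_dist X G 2 0 /\ F = sub_col 2 0 G].

Definition sva_step X G G' : Prop :=
  exists F, [/\ sva_subtract X G F,
    exists s : 'S_3, G' = col_perm s F &
    enorm (projD X (rcol G' 0)) <= enorm (projD X (rcol G' 1))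
      <= enorm (projD X (rcol G' 2))].

Definition sva_run X (G : nat -> 'M[int]_3) : Prop :=
  G 0%N = 1%:M /\ forall s, sva_step X (G s) (G s.+1).

Definition cofactor_vec X (G : nat -> 'M[int]_3) (s : nat) : 'cV[R]_3 :=
  \col_i (enorm X * enorm (projD X (rcol (G s) i))).

Definition cofactor_ratios X (G : nat -> 'M[int]_3) (s : nat) : R * R :=
  let Xs := cofactor_vec X G s in (Xs 0 0 / Xs 2 0, Xs 1 0 / Xs 2 0).

Definition pos_increasing X : Prop :=
  [/\ 0 < X 0 0, X 0 0 < X 1 0 & X 1 0 < X 2 0].

Definition rat_independent X : Prop :=
  forall q : 'I_3 -> rat,
    \sum_i ratr (q i) * X i 0 = 0 -> forall i, q i = 0.

End SmallestVector.

Section AlgebraicNumbers.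
Variable R : realType.
Implicit Types x y : R.

Definition qeval (p : {poly rat}) x : R := (map_poly ratr p).[x].

Definition Qadjoin x : set R := [set y | exists p : {poly rat}, y = qeval p x].

Definition algebraic_integer x : Prop := integralOver (intr : int -> R) x.

Definition algebraic_degree x (n : nat) : Prop :=
  exists p : {poly rat},
    [/\ irreducible_poly p, qeval p x = 0 & size p = n.+1].

(* A unit of the ring of algebraic integers. *)
Definition algebraic_unit x : Prop :=
  algebraic_integer x /\ exists y, algebraic_integer y /\ x * y = 1.

Definition rational_function_of x y : Prop :=
  exists p q : {poly rat}, qeval q x <> 0 /\ y = qeval p x / qeval q x.

End AlgebraicNumbers.

(* Main.v *)
Require Import Defs.
From mathcomp Require Import all_boot all_order all_fingroup all_algebra.
From mathcomp Require Import all_classical reals.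
From mathcomp Require Import ring lra zify.

(** Put [x = G^T X] (the cofactors) and [w = G^-1 X].  Subtracting column [i] from
    column [j] adds [w_j] to [w_i], so both stay positive, and [w_k / |X|] is the
    area of the parallelogram spanned by the projections [r_i], [r_j] of the two
    other columns.  The shortest-side rule keeps the triangle of the [r_k] fat:
    their squared lengths are bounded by a multiple of the total area, because a
    vector can only be lengthened in a thin triangle close to (-l, 0), (0, 0),
    (l, 0), and then the area grows accordingly within two steps.  As
    [sum_k w_k x_k = |X|^2], this gives [x_0 |r_k|^2 = O(1)].

    If the coordinates of [X] span a cubic field, an integer matrix [B] satisfies
    [B X = theta X] with [theta] of degree 3.  The nonzero integral determinants of
    [g, B^T g, B^T^2 g] and [h, B h, B^2 h] bound [|g.X| |g|^2] and [|h| |h'|^2] from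
    below.  Whenever [x_0] decreases (this happens infinitely often, by finiteness)
    these bounds yield [x_2 |r_k|^2 = O(1)], so that the integer matrices
    [G^T B G^-T] stay bounded and two of them coincide.  They have the vectors [x]
    as eigenvectors for the simple eigenvalue [theta], whence the loop.

    Conversely a loop makes [X] an eigenvector of a unimodular integer matrix with
    eigenvalue [0 < lambda < 1]; a rational eigenvalue would force this matrix to
    be scalar, so its characteristic polynomial is irreducible. *)

Set Implicit Arguments.
Unset Strict Implicit.
Unset Printing Implicit Defensive.

Import Order.TTheory GRing.Theory Num.Theory.
Local Open Scope ring_scope.

(** * Triangles around the origin *)

(** Two vectors have lengths [a], [b], inner product [u] and area [w]. As [w <= a * b / 2], the size
    of [u] is at least [sqrt 3 / 2] times [a * b], which exceeds both [w] and [b ^+ 2 / 2]; so [u]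
    can only be negative. *)
Lemma long_vectors_opposite (R : realType) (l a b u w : R) :
  0 < l -> l <= 10 * b -> b <= a -> 0 < w -> 200 * w <= l ^+ 2 ->
  2 * u < b ^+ 2 -> a ^+ 2 * b ^+ 2 = u ^+ 2 + w ^+ 2 ->
  u < 0 /\ w < - u.
Proof.
move=> l0 lb ba w0 wl ub e.
have b0 : 0 < b by lra.
have h3 : b ^+ 2 <= a ^+ 2 by rewrite ler_sqr ?nnegrE; lra.
have h1 : l ^+ 4 <= 100 * 100 * (a ^+ 2 * b ^+ 2).
  have h2 : l ^+ 2 <= 100 * b ^+ 2 by nra.
  nra.
have h4 : 200 * 200 * w ^+ 2 <= l ^+ 4.
  have : (200 * w) ^+ 2 <= (l ^+ 2) ^+ 2 by rewrite ler_sqr ?nnegrE; nra.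
  by rewrite exprMn -exprM expr2.
have w20 : 0 < w ^+ 2 by nra.
have un : u < 0.
  rewrite ltNge; apply/negP => u0.
  have : (2 * u) ^+ 2 <= (b ^+ 2) ^+ 2 by rewrite ler_sqr ?nnegrE; nra.
  have : b ^+ 2 * b ^+ 2 <= a ^+ 2 * b ^+ 2 by rewrite ler_wpM2r //; nra.
  nra.
split => //.
rewrite -(@ltr_pXn2r _ 2) ?nnegrE //; nra.
Qed.

Lemma sqr_le (R : realType) (a b : R) : 0 <= a -> a <= b -> a ^+ 2 <= b ^+ 2.
Proof. by move=> a0 ab; rewrite !expr2; apply: ler_pM. Qed.

Lemma le_of_sqr (R : realType) (x y : R) : 0 <= y -> x ^+ 2 <= y ^+ 2 -> x <= y.
Proof. by move=> y0 h; rewrite leNgt; apply/negP => yx; nra. Qed.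

(** The last equation bounds [2 * uab] below by [- (a * b)], and [b ^+ 2] bounds it above. Hence
    [wc] is at least [sqrt 3 / 2] times [a * b], where [a] is close to [l]. *)
Lemma area_lower_bound (R : realType) (l a b c uab ubc uac wa wb wc : R) :
  0 < l -> 0 <= b -> b <= a <= l -> c <= l ->
  10 * b <= l -> 9 * l <= 10 * a -> 9 * l <= 10 * c ->
  0 < wa -> 0 < wb -> 0 < wc -> 200 * wb <= l ^+ 2 -> 
  uac < 0 -> 2 * uab < b ^+ 2 -> 2 * ubc < b ^+ 2 ->
  a ^+ 2 * b ^+ 2 = uab ^+ 2 + wc ^+ 2 ->
  b ^+ 2 * c ^+ 2 = ubc ^+ 2 + wa ^+ 2 ->
  a ^+ 2 * c ^+ 2 = uac ^+ 2 + wb ^+ 2 ->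
  c ^+ 2 * uab = uac * ubc - wa * wb ->
  l * b <= 2 * wc.
Proof.
move=> l0 b0 /andP[ba al] cl bl la lc wa0 wb0 wc0 wbl uac0 uabb ubcb e1 e2 e3 e4.
have b1 : wa <= b * c by apply: le_of_sqr; nra.
have b2 : - uac <= a * c by apply: le_of_sqr; nra.
have bb0 : 0 <= b ^+ 2 by nra.
have c0 : 0 < c by lra.
have ac0 : 0 <= a * c by apply: mulr_ge0; lra.
have h1 : - (a * c * b ^+ 2) <= 2 * (uac * ubc).
  have : - uac * (2 * ubc) <= - uac * b ^+ 2 by rewrite ler_wpM2l //; lra.
  have : - uac * b ^+ 2 <= a * c * b ^+ 2 by rewrite ler_wpM2r.
  nra.
have h2 : 200 * (wa * wb) <= b * c * l ^+ 2.
  have : wa * (200 * wb) <= b * c * l ^+ 2 by apply: ler_pM => //; lra.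
  nra.
have h3 : - (100 * a * b ^+ 2) - b * l ^+ 2 <= 200 * c * uab.
  rewrite -(ler_pM2l c0).
  have -> : c * (200 * c * uab) = 200 * (c ^+ 2 * uab) by ring.
  rewrite e4; nra.
have ab0 : 0 <= a * b by apply: mulr_ge0; lra.
have h4 : - (a * b) <= 2 * uab.
  rewrite -(ler_pM2l c0).
  have h5 : a * b ^+ 2 * 10 <= a * b * l by nra.
  have h6 : 81 * l ^+ 2 <= 100 * (a * c) by nra.
  have h7 : b * l ^+ 2 * 81 <= 100 * (a * b * c) by nra.
  have h8 : 9 * (a * b * l) <= 10 * (a * b * c) by nra.
  nra.
have h5 : 2 * uab <= a * b by nra.
have h6 : 4 * uab ^+ 2 <= (a * b) ^+ 2 by nra.
have h7 : 3 * (a * b) ^+ 2 <= 4 * wc ^+ 2 by nra.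
apply: le_of_sqr; first by lra.
have : 9 * (l * b) <= 10 * (a * b) by nra.
have : 0 <= l * b by nra.
nra.
Qed.

(* A planar triangle which contains the origin, whose sides all exceed the
   distance [l] of the vertices from the origin and whose area is small
   compared with [l ^+ 2] has to look like (-l, 0), (0, 0), (l, 0). *)
Lemma thin_triangle (R : realType) (l a b c uab ubc uac wa wb wc : R) :
  0 < l -> 0 <= b -> b <= a <= l -> b <= c <= l ->
  0 < wa -> 0 < wb -> 0 < wc -> 200 * (wa + wb + wc) <= l ^+ 2 ->
  a ^+ 2 * b ^+ 2 = uab ^+ 2 + wc ^+ 2 ->
  b ^+ 2 * c ^+ 2 = ubc ^+ 2 + wa ^+ 2 ->
  a ^+ 2 * c ^+ 2 = uac ^+ 2 + wb ^+ 2 ->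
  c ^+ 2 * uab = uac * ubc - wa * wb ->
  a ^+ 2 * ubc = uab * uac - wb * wc ->
  l ^+ 2 < a ^+ 2 + b ^+ 2 - 2 * uab ->
  l ^+ 2 < b ^+ 2 + c ^+ 2 - 2 * ubc ->
  l ^+ 2 < a ^+ 2 + c ^+ 2 - 2 * uac ->
  [/\ 10 * b <= l, l * b <= 2 * wc, l * b <= 2 * wa &
      [/\ 9 * l <= 10 * a, 9 * l <= 10 * c & 10 * uac <= - (9 * (a * c))]].
Proof.
move=> l0 b0 /andP[ba al] /andP[bc cl] wa0 wb0 wc0 wl e1 e2 e3 e4 e5 s1 s2 s3.
have a2 : a ^+ 2 <= l ^+ 2 by rewrite ler_sqr ?nnegrE; lra.
have c2 : c ^+ 2 <= l ^+ 2 by rewrite ler_sqr ?nnegrE; lra.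
(* If all three vectors were long, their pairwise angles would all exceed 135 degrees; but then [e4]
   makes [uab] positive. *)
have bl : 10 * b <= l.
  rewrite leNgt; apply/negP => lb.
  have [u1 v1] : uab < 0 /\ wc < - uab
    by apply: (@long_vectors_opposite _ l a b uab wc) => //; lra.
  have [u2 v2] : ubc < 0 /\ wa < - ubc.
    by apply: (@long_vectors_opposite _ l c b ubc wa) => //; lra.
  have [u3 v3] : uac < 0 /\ wb < - uac.
    have [ac|ca] := leP a c.
      by apply: (@long_vectors_opposite _ l c a uac wb) => //; lra.
    by apply: (@long_vectors_opposite _ l a c uac wb) => //; lra.
  nra.
have la : 9 * l <= 10 * a.
  have : - uab <= a * b by apply: le_of_sqr; nra.
  move=> h; have : l <= a + b by apply: le_of_sqr; nra.
  lra.
have lc : 9 * l <= 10 * c.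
  have : - ubc <= b * c by apply: le_of_sqr; nra.
  move=> h; have : l <= b + c by apply: le_of_sqr; nra.
  lra.
have [u3 v3] : uac < 0 /\ wb < - uac.
  have [ac|ca] := leP a c.
    by apply: (@long_vectors_opposite _ l c a uac wb) => //; lra.
  by apply: (@long_vectors_opposite _ l a c uac wb) => //; lra.
split => //.
- by apply: (@area_lower_bound _ l a b c uab ubc uac wa wb wc) => //; lra.
- apply: (@area_lower_bound _ l c b a ubc uab uac wc wb wa) => //; lra.
split => //.
have h1 : 81 * l ^+ 2 <= 100 * (a * c) by nra.
have ac0 : 0 <= a * c by nra.
have h2 : 2 * wb <= a * c / 10 by nra.
have h3 : (9 * (a * c)) ^+ 2 <= (10 * - uac) ^+ 2.
  have -> : (10 * - uac) ^+ 2 = 100 * (a ^+ 2 * c ^+ 2 - wb ^+ 2).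
    by rewrite e3; ring.
  nra.
have : 9 * (a * c) <= 10 * - uac by apply: le_of_sqr => //; lra.
lra.
Qed.

(** * Inner products and labellings of three indices *)

Section Dot.
Variable R : realType.
Implicit Types u v w : 'cV[R]_3.

Lemma dotC u v : dot u v = dot v u.
Proof. by apply: eq_bigr => i _; rewrite mulrC. Qed.

Lemma dotBr u v w : dot u (v - w) = dot u v - dot u w.
Proof. by rewrite dotC dotBl !(dotC u). Qed.

Lemma dotZr (a : R) u v : dot u (a *: v) = a * dot u v.
Proof. by rewrite dotC dotZl dotC. Qed.

Lemma dot_sqrB u v : dot (u - v) (u - v) = dot u u + dot v v - 2 * dot u v.
Proof. by rewrite dotBl !dotBr (dotC v u); ring. Qed.

Lemma dot_ge0 u : 0 <= dot u u.
Proof. by apply: sumr_ge0 => i _; rewrite -expr2 sqr_ge0. Qed.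

Lemma enorm_ge0 u : 0 <= enorm u.
Proof. exact: sqrtr_ge0. Qed.

Lemma enorm_sqr u : enorm u ^+ 2 = dot u u.
Proof. by rewrite sqr_sqrtr ?dot_ge0. Qed.

End Dot.

Definition distinct3 (a b c : 'I_3) := [&& a != b, b != c & a != c].

Lemma distinct3_swap (a b c : 'I_3) : distinct3 a b c -> distinct3 c b a.
Proof.
by case/and3P => ? ? ?; apply/and3P; split; rewrite eq_sym.
Qed.

Lemma distinct3_rot (a b c : 'I_3) : distinct3 a b c -> distinct3 b c a.
Proof.
by case/and3P => ? ? ?; apply/and3P; split => //; rewrite eq_sym.
Qed.

Lemma third_index (a b : 'I_3) : a != b -> exists c, distinct3 a b c.
Proof.
have : [forall a : 'I_3, forall b : 'I_3, (a != b) ==> [exists c, distinct3 a b c]].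
  apply/forallP => -[[|[|[|?]]] ?] //; apply/forallP => -[[|[|[|?]]] ?] //;
  apply/implyP => // _; apply/existsP;
  by [exists 0 | exists 1 | exists 2].
by move/forallP/(_ a)/forallP/(_ b)/implyP => h /h /existsP.
Qed.

Lemma distinct3_cases (a b c k : 'I_3) : distinct3 a b c ->
  [\/ k = a, k = b | k = c].
Proof.
move: a b c k => [[|[|[|?]]] ?] [[|[|[|?]]] ?] [[|[|[|?]]] ?] [[|[|[|?]]] ?] //= _;
  by [apply: Or31; apply: val_inj | apply: Or32; apply: val_inj
     | apply: Or33; apply: val_inj].
Qed.

Lemma sum_distinct3 (V : zmodType) (f : 'I_3 -> V) (a b c : 'I_3) :
  distinct3 a b c -> \sum_k f k = f a + f b + f c.
Proof.
case/and3P => ab bc ac.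
rewrite (bigD1 a) //= (bigD1 b) 1?eq_sym //= (bigD1 c) /=; last first.
  by rewrite ![c == _]eq_sym ac bc.
rewrite big1 ?addr0 ?addrA // => k /andP[/andP[ka kb] kc].
have [] := @distinct3_cases a b c k; first by apply/and3P.
- by move/eqP; rewrite (negPf ka).
- by move/eqP; rewrite (negPf kb).
- by move/eqP; rewrite (negPf kc).
Qed.

(** * Evolution of the projected triangle when its shortest side is subtracted *)

Section Triangle.
Variable R : realType.
Implicit Types (r : 'I_3 -> 'cV[R]_3) (v : 'I_3 -> R).

(* [v c] is the area of the parallelogram on [r a] and [r b]; the second
   equation also says that the origin lies inside the triangle. *)
Definition planar r v := forall a b c, distinct3 a b c ->
  [/\ 0 < v c,
      dot (r a) (r a) * dot (r b) (r b) = dot (r a) (r b) ^+ 2 + v c ^+ 2 &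
      dot (r a) (r a) * dot (r b) (r c) =
        dot (r a) (r b) * dot (r a) (r c) - v b * v c].

Definition sub_vec r (j i : 'I_3) : 'I_3 -> 'cV[R]_3 :=
  fun k => if k == j then r j - r i else r k.

(** Effect of [sub_vec] on the areas: as the origin lies inside the triangle, the parallelogram on
    [r j - r i] and the third vector has area [v i + v j]. *)
Definition add_area v (j i : 'I_3) : 'I_3 -> R :=
  fun k => if k == i then v i + v j else v k.

(** The factor 200 is the one in [thin_triangle]; [c0] leaves room for the initial vectors. *)
Definition area_bound (c0 : R) v : R := 200 * \sum_k v k + c0.

(* The short-lived exception to the bound on the lengths: [r b] has just been
   lengthened by [r a], and the next step subtracts [r b] and [r c]. *)
Definition exceptional (c0 : R) r v (a b c : 'I_3) (l be : R) := [/\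
  distinct3 a b c, 0 <= be <= l, l ^+ 2 <= area_bound c0 v, l * be <= 2 * v c &
  [/\ dot (r a) (r a) <= l ^+ 2, dot (r c) (r c) <= l ^+ 2,
      dot (r b) (r b) <= (l + be) ^+ 2 &
  [/\ dot (r b - r c) (r b - r c) <= l ^+ 2,
      dot (r b - r c) (r b - r c) < dot (r a - r c) (r a - r c) &
      dot (r b - r c) (r b - r c) < dot (r a - r b) (r a - r b)]]].

Definition fat (c0 : R) r v :=
  (forall k, dot (r k) (r k) <= area_bound c0 v) \/
  exists a b c l be, exceptional c0 r v a b c l be.

Definition closest r (j i : 'I_3) := forall l m, l != m ->
  dot (r j - r i) (r j - r i) <= dot (r l - r m) (r l - r m).

Lemma dot_distC u w : dot (u - w) (u - w) = dot (w - u) (w - u) :> R.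
Proof. by rewrite !dot_sqrB (dotC w u); ring. Qed.

Lemma closestC r j i : closest r j i -> closest r i j.
Proof. by move=> h l m lm; rewrite dot_distC; apply: h. Qed.

Lemma area_bound_add c0 v j i : i != j ->
  area_bound c0 (add_area v j i) = area_bound c0 v + 200 * v j.
Proof.
move=> ij; have [k d] := third_index ij.
rewrite /area_bound !(sum_distinct3 _ d) /add_area eqxx.
case/and3P: d => h1 h2 h3.
rewrite ![_ == i]eq_sym (negPf ij) (negPf h3); ring.
Qed.

Lemma planar_gt0 r v k : planar r v -> 0 < v k.
Proof.
move=> h; have [a ka] : exists a : 'I_3, k != a.
  by case: (eqVneq k 0) => [->|]; [exists 1 | exists 0].
by have [b d] := third_index ka; case: (h _ _ _ (distinct3_rot d)).
Qed.

Lemma area_bound_gt0 c0 r v : planar r v -> 0 <= c0 -> 0 < area_bound c0 v.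
Proof.
move=> h c00; rewrite /area_bound.
have d : distinct3 0 1 2 by [].
rewrite (sum_distinct3 _ d).
have := planar_gt0 0 h; have := planar_gt0 1 h.
have := planar_gt0 2 h; lra.
Qed.

(** The lengthened vector of an exceptional state has length at most [l + be <= 2 * l], whence the
    factor 4. *)
Lemma fat_bound c0 r v k : planar r v -> 0 <= c0 -> fat c0 r v ->
  dot (r k) (r k) <= 4 * area_bound c0 v.
Proof.
move=> pl c00; have L0 := area_bound_gt0 pl c00.
case=> [/(_ k)|[a [b [c [l [be]]]]]]; first lra.
case=> d /andP[be0 bel] lL _ [ra rc rb _].
have : (l + be) ^+ 2 <= 4 * l ^+ 2 by nra.
by have [->|->|->] := distinct3_cases k d; lra.
Qed.

(** The shape found in [thin_triangle]: [r b] is near the origin, [r a] and [r c] are long and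
    almost opposite. *)
Definition thin r v (a b c : 'I_3) (l : R) := [/\
  distinct3 a b c, 10 * enorm (r b) <= l, l * enorm (r b) <= 2 * v c,
  l * enorm (r b) <= 2 * v a &
  [/\ 9 * l <= 10 * enorm (r a) <= 10 * l, 9 * l <= 10 * enorm (r c) <= 10 * l &
      10 * dot (r a) (r c) <= - (9 * (enorm (r a) * enorm (r c)))]].

Lemma thinC r v a b c l : thin r v a b c l -> thin r v c b a l.
Proof.
case=> d h1 h2 h3 [h4 h5 h6]; split => //; first exact: distinct3_swap.
by split => //; rewrite dotC (mulrC (enorm (r c))).
Qed.

Lemma shortest_vertex r : exists a b c,
  [/\ distinct3 a b c, enorm (r b) <= enorm (r a) & enorm (r b) <= enorm (r c)].
Proof.
have [h01|h10] := leP (enorm (r 0)) (enorm (r 1)).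
  have [h02|h20] := leP (enorm (r 0)) (enorm (r 2)).
    by exists 1, 0, 2.
  by exists 0, 2, 1; split => //; lra.
have [h12|h21] := leP (enorm (r 1)) (enorm (r 2)).
  by exists 0, 1, 2; split => //; lra.
by exists 0, 2, 1; split => //; lra.
Qed.

Lemma thin_of_long_sides c0 r v (l : R) : planar r v -> 0 < l -> 0 <= c0 ->
  l ^+ 2 = area_bound c0 v -> (forall k, dot (r k) (r k) <= l ^+ 2) ->
  (forall i j, i != j -> l ^+ 2 < dot (r i - r j) (r i - r j)) ->
  exists a b c, thin r v a b c l.
Proof.
move=> pl l0 c00 lL rl sl.
have rl' k : enorm (r k) <= l.
  by apply: le_of_sqr; [exact: ltW | rewrite enorm_sqr].
have [a [b [c [d ba bc]]]] := shortest_vertex r.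
exists a, b, c.
have [va e1 e1'] := pl _ _ _ (distinct3_rot d).
have [vb e2 e2'] := pl _ _ _ (distinct3_rot (distinct3_rot d)).
have [vc e3 e3'] := pl _ _ _ d.
case/and3P: (d) => ab bc' ac.
have := @thin_triangle R l (enorm (r a)) (enorm (r b)) (enorm (r c))
  (dot (r a) (r b)) (dot (r b) (r c)) (dot (r a) (r c)) (v a) (v b) (v c).
case=> //; rewrite ?rl' ?ba ?bc ?enorm_ge0 ?enorm_sqr -?dot_sqrB //; try exact: sl.
- rewrite lL /area_bound (sum_distinct3 _ d); lra.
- by rewrite mulrC e2 dotC.
- by rewrite e2' (dotC (r c) (r a)) (dotC (r c) (r b)).
move=> h1 h2 h3 [h4 h5 h6]; split => //; split=> //.
  by rewrite h4 ler_pM2l ?rl' // ltr0n.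
by rewrite h5 ler_pM2l ?rl' // ltr0n.
Qed.

Lemma dot_le_enorm r v a b c : planar r v -> distinct3 a b c ->
  - (enorm (r a) * enorm (r b)) <= dot (r a) (r b) <= enorm (r a) * enorm (r b).
Proof.
move=> pl d; have [_ e _] := pl _ _ _ d.
have h : 0 <= enorm (r a) * enorm (r b) by rewrite mulr_ge0 ?enorm_ge0.
have h2 : dot (r a) (r b) ^+ 2 <= (enorm (r a) * enorm (r b)) ^+ 2.
  by rewrite exprMn !enorm_sqr e; have := sqr_ge0 (v c); lra.
apply/andP; split; last exact: le_of_sqr.
by rewrite lerNl; apply: le_of_sqr; rewrite ?sqrrN.
Qed.

(** When [r a] changes, it grows by at most the length of [r b], which the gain
    [200 * v a >= 100 * l * enorm (r b)] pays for. When [r b] changes, the gain [200 * v b] may be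
    too small, and the state becomes exceptional. *)
Lemma fat_step_thin c0 r v a b c l j i : planar r v -> 0 < l ->
  thin r v a b c l -> (forall k, dot (r k) (r k) <= l ^+ 2) ->
  l ^+ 2 = area_bound c0 v ->
  (j = a /\ i = b) \/ (j = b /\ i = a) ->
  fat c0 (sub_vec r j i) (add_area v j i).
Proof.
move=> pl l0 [d h1 h2 h3 [/andP[h4 h4'] /andP[h5 h5'] h6]] rl lL ji.
have /andP[uab1 uab2] := dot_le_enorm pl d.
have /andP[ubc1 ubc2] := dot_le_enorm pl (distinct3_rot d).
have := rl a; have := rl b; have := rl c.
move: (enorm_sqr (r a)) (enorm_sqr (r b)) (enorm_sqr (r c)).
move: (enorm_ge0 (r a)) (enorm_ge0 (r b)) (enorm_ge0 (r c)) => a0 b0 c0'.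
move=> ea eb ec rlc rlb rla.
case/and3P: (d) => ab bc ac.
have ji' : i != j by case: ji => -[-> ->]; rewrite // eq_sym.
have vj := planar_gt0 j pl.
set A := enorm (r a) in h4 h4' h6 uab1 uab2 ea a0.
set B := enorm (r b) in h1 h2 h3 uab1 uab2 ubc1 ubc2 eb b0.
set D := enorm (r c) in h5 h5' h6 ubc1 ubc2 ec c0'.
have AB0 : 0 <= A * B by rewrite mulr_ge0.
have AB : 10 * (A * B) <= l ^+ 2 by nra.
have BD : 10 * (B * D) <= l ^+ 2 by nra.
have lB : 0 <= l * B by nra.
have B2 : B ^+ 2 <= l * B by nra.
have sab : dot (r a - r b) (r a - r b) <= (l + B) ^+ 2.
  by rewrite dot_sqrB -ea -eb; nra.
case: ji => -[ej ei]; subst j i.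
  left => k; rewrite area_bound_add // /sub_vec.
  case: eqP => _; last by have := rl k; lra.
  nra.
(* The new vector [r b - r a] lies close to [r c], so these two form the shortest side of the next
   triangle. *)
right; exists a, b, c, l, B; split => //.
- by apply/andP; split => //; lra.
- by rewrite area_bound_add //; lra.
- by rewrite /add_area eq_sym (negPf ac).
rewrite /sub_vec (negPf ab) [c == b]eq_sym (negPf bc) eqxx; split => //.
  by rewrite dot_distC.
have AD : 81 * l ^+ 2 <= 100 * (A * D) by nra.
have A2 : 81 * l ^+ 2 <= 100 * A ^+ 2 by nra.
have D2 : 81 * l ^+ 2 <= 100 * D ^+ 2 by nra.
have B2' : 100 * B ^+ 2 <= l ^+ 2 by nra.
have AmD : 100 * (A - D) ^+ 2 <= l ^+ 2 by nra.
have AD' : A * D <= l ^+ 2 by nra.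
have l20 : 0 < l ^+ 2 by nra.
have e1 : dot (r b - r a - r c) (r b - r a - r c) =
    B ^+ 2 + ((A - D) ^+ 2 + 2 * (A * D)) + 2 * dot (r a) (r c)
    - 2 * dot (r a) (r b) - 2 * dot (r b) (r c).
  by rewrite !(dotBl, dotBr) (dotC (r b) (r a)) (dotC (r c)) (dotC (r c))
     -ea -eb -ec; ring.
have e2 : dot (r a - r c) (r a - r c) = A ^+ 2 + D ^+ 2 - 2 * dot (r a) (r c).
  by rewrite dot_sqrB -ea -ec.
have e3 : dot (r a - (r b - r a)) (r a - (r b - r a)) =
    4 * A ^+ 2 + B ^+ 2 - 4 * dot (r a) (r b).
  by rewrite !(dotBl, dotBr) (dotC (r b) (r a)) -ea -eb; ring.
by split; rewrite e1 ?e2 ?e3; lra.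
Qed.

(** If the shortest side is within the bound, so is the new vector. Otherwise all sides are long,
    the triangle is thin, and its shortest side contains the vertex near the origin. In an
    exceptional state the closest pair is [r b] and [r c]; the step either replaces the long vector
    [r b] or gains [200 * v c], which pays for it. *)
Lemma fat_step c0 r v j i : planar r v -> 0 <= c0 -> fat c0 r v -> i != j ->
  closest r j i -> fat c0 (sub_vec r j i) (add_area v j i).
Proof.
move=> pl c00 ft ij cl.
have L0 := area_bound_gt0 pl c00.
have vj := planar_gt0 j pl.
case: ft => [rL|[a [b [c [l [be]]]]]].
  have [hL|hL] := leP (dot (r j - r i) (r j - r i)) (area_bound c0 v).
    left => k; rewrite area_bound_add // /sub_vec.
    by case: eqP => _; [lra | have := rL k; lra].
  have l2 : Num.sqrt (area_bound c0 v) ^+ 2 = area_bound c0 v.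
    by rewrite sqr_sqrtr // ltW.
  have l0 : 0 < Num.sqrt (area_bound c0 v) by rewrite sqrtr_gt0.
  set l := Num.sqrt _ in l2 l0; rewrite -l2 in hL.
  have rl k : dot (r k) (r k) <= l ^+ 2 by rewrite l2.
  have sl k m : k != m -> l ^+ 2 < dot (r k - r m) (r k - r m).
    by move=> km; apply: lt_le_trans hL (cl _ _ km).
  have [a [b [c th]]] := thin_of_long_sides pl l0 c00 l2 rl sl.
  case: (th) => d h1 h2 h3 [/andP[h4 h4'] /andP[h5 h5'] h6].
  case/and3P: (d) => ab bc ac.
  have ac_long : dot (r a - r b) (r a - r b) < dot (r a - r c) (r a - r c).
    have /andP[uab1 uab2] := dot_le_enorm pl d.
    rewrite !dot_sqrB -!enorm_sqr.
    move: (enorm_ge0 (r a)) (enorm_ge0 (r b)) (enorm_ge0 (r c)) => a0 b0 c0'.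
    set A := enorm (r a) in h4 h4' h6 uab1 uab2 a0 *.
    set B := enorm (r b) in h1 h2 h3 uab1 uab2 b0 *.
    set D := enorm (r c) in h5 h5' h6 c0' *.
    have : 10 * (A * B) <= l ^+ 2 by nra.
    have : 81 * l ^+ 2 <= 100 * D ^+ 2 by nra.
    have : 100 * B ^+ 2 <= l ^+ 2 by nra.
    have : 0 <= A * D by nra.
    have : 0 < l ^+ 2 by nra.
    lra.
  have th' := thinC th.
  have [ej|ej|ej] := distinct3_cases j d;
    have [ei|ei|ei] := distinct3_cases i d; subst i j;
    rewrite ?eqxx // in ij.
  - by apply: (fat_step_thin pl l0 th rl l2); left.
  - by have := cl _ _ ab; lra.
  - by apply: (fat_step_thin pl l0 th rl l2); right.
  - by apply: (fat_step_thin pl l0 th' rl l2); right.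
  - by have := closestC cl ab; lra.
  - by apply: (fat_step_thin pl l0 th' rl l2); left.
case=> d /andP[be0 bel] lL lbe [ra rc rb [s1 s2 s3]].
case/and3P: (d) => ab bc ac.
have ji : (j = b /\ i = c) \/ (j = c /\ i = b).
  have [ej|ej|ej] := distinct3_cases j d;
    have [ei|ei|ei] := distinct3_cases i d; subst i j;
    rewrite ?eqxx // in ij; try (by [left | right]);
    exfalso; have := cl _ _ bc; rewrite ?(dot_distC (r b) (r a)) ?(dot_distC (r c) (r a)); lra.
left => k; rewrite area_bound_add // /sub_vec.
case: ji => -[ej ei]; subst i j.
  have [->|->|->] := distinct3_cases k d; rewrite ?eqxx ?(negPf ab) //.
  - lra.
  - lra.
  - by rewrite eq_sym (negPf bc); lra.
have [->|->|->] := distinct3_cases k d;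
  rewrite ?eqxx ?(negPf ac) ?(negPf bc) //.
- lra.
- nra.
- by rewrite dot_distC; lra.
Qed.

End Triangle.

(** * States of the algorithm *)

Section Det3.
Variable R : realType.
Implicit Types u v t X : 'cV[R]_3.

Lemma dotE u v : dot u v = u 0 0 * v 0 0 + u 1 0 * v 1 0 + u 2 0 * v 2 0.
Proof. by rewrite /dot (@sum_distinct3 _ _ 0 1 2). Qed.

Definition det3 u v t : R :=
  u 0 0 * (v 1 0 * t 2 0 - v 2 0 * t 1 0) -
  u 1 0 * (v 0 0 * t 2 0 - v 2 0 * t 0 0) +
  u 2 0 * (v 0 0 * t 1 0 - v 1 0 * t 0 0).

Lemma dot_projP X u v : X != 0 ->
  dot (projP X u) (projP X v) = dot u v - dot u X * dot v X / dot X X.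
Proof.
move=> X0; have n0 : dot X X != 0 by rewrite dot_eq0.
rewrite /projP /projD !(dotBl, dotBr, dotZl, dotZr) (dotC X v); field.
by [].
Qed.

Lemma projPB X u v : projP X (u - v) = projP X u - projP X v.
Proof.
rewrite /projP /projD dotBl mulrBl scalerBl.
by apply/colP => m; rewrite !mxE; ring.
Qed.

(** The Binet-Cauchy identity in the plane orthogonal to [X], where the cross product of the
    projections of [u] and [v] is [det3 u v X / enorm X] times a unit normal. Both equations of
    [planar] are instances. *)
Lemma gram_projP X u v t : X != 0 ->
  dot (projP X u) (projP X u) * dot (projP X v) (projP X t) =
  dot (projP X u) (projP X v) * dot (projP X u) (projP X t) +
  det3 u v X * det3 u t X / dot X X.
Proof.
move=> X0; have n0 : dot X X != 0 by rewrite dot_eq0.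
rewrite !dot_projP //.
have -> : det3 u v X * det3 u t X =
   dot X X * (dot u u * dot v t - dot u v * dot u t) +
   dot u X * (dot u v * dot t X + dot u t * dot v X) -
   dot u u * (dot v X * dot t X) - dot u X * dot u X * dot v t.
  by rewrite !dotE /det3; ring.
by field.
Qed.

Lemma dotDl u v t : dot (u + v) t = dot u t + dot v t.
Proof. by rewrite !dotE !mxE; ring. Qed.

Lemma dotDr u v t : dot t (u + v) = dot t u + dot t v.
Proof. by rewrite !dotE !mxE; ring. Qed.

Lemma dot_sqrB_le u v : dot (u - v) (u - v) <= 2 * dot u u + 2 * dot v v.
Proof.
have := dot_ge0 (u + v); rewrite dot_sqrB !(dotDl, dotDr) (dotC v u); lra.
Qed.

Lemma dot_entry_bound u v (a b : R) : (forall k, `|u k 0| <= a) ->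
  (forall k, `|v k 0| <= b) -> `|dot u v| <= 3 * (a * b).
Proof.
move=> ua vb; have h k : `|u k 0 * v k 0| <= a * b by rewrite normrM ler_pM.
have := h 0; have := h 1; have := h 2; rewrite dotE !ler_norml.
by move=> /andP[a1 a2] /andP[b1 b2] /andP[c1 c2]; apply/andP; split; lra.
Qed.

Definition cross u v : 'cV[R]_3 :=
  \col_k nth 0 [:: u 1 0 * v 2 0 - u 2 0 * v 1 0;
                   u 2 0 * v 0 0 - u 0 0 * v 2 0;
                   u 0 0 * v 1 0 - u 1 0 * v 0 0] k.

Lemma dot_cross u v t : dot (cross u v) t = det3 u v t.
Proof. by rewrite dotE !mxE /= /det3; ring. Qed.

Lemma cross_sqr u v :
  dot (cross u v) (cross u v) = dot u u * dot v v - dot u v ^+ 2.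
Proof. by rewrite !dotE !mxE /=; ring. Qed.

(** The right side is the expanded Gram determinant. *)
Lemma det3_sqr u v t : det3 u v t ^+ 2 =
  dot t t * (dot u u * dot v v - dot u v ^+ 2) + 2 * (dot u t * dot v t * dot u v)
  - dot u u * dot v t ^+ 2 - dot v v * dot u t ^+ 2.
Proof. by rewrite !dotE /det3; ring. Qed.

End Det3.

(** * Unimodular states with positive coordinates and cofactors *)

Section States.
Variable R : realType.
Implicit Types (X : 'cV[R]_3) (G F : 'M[int]_3) (w : 'I_3 -> R).

Definition rproj X G (k : 'I_3) : 'cV[R]_3 := projP X (rcol R G k).
Definition xval X G (k : 'I_3) : R := dot (rcol R G k) X.

Lemma rcolE G k m : rcol R G k m 0 = (G m k)%:~R.
Proof. by rewrite !mxE. Qed.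

Lemma det_mx33 (A : 'M[R]_3) : \det A = det3 (col 0 A) (col 1 A) (col 2 A).
Proof.
(* Entries read through natural numbers let the lifted indices of the minors compute. *)
pose f (i j : nat) := A (inord i) (inord j).
have E i j : A i j = f i j by rewrite /f !inord_val.
rewrite (expand_det_col _ 0) !big_ord_recl big_ord0 /cofactor.
rewrite !(expand_det_col _ 0) !big_ord_recl !big_ord0 /cofactor !det_mx11.
rewrite /det3 !mxE !E /= /bump /= !addn0 !addn1 /=; ring.
Qed.

Lemma det3_rcol G : det3 (rcol R G 0) (rcol R G 1) (rcol R G 2) = (\det G)%:~R.
Proof. by rewrite -det_map_mx det_mx33 /rcol -!map_col. Qed.


Definition state X G w := [/\ G \in unitmx,
  X = \sum_k w k *: rcol R G k, forall k, 0 < w k & forall k, 0 < xval X G k].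

(** By Cramer's rule [w k] is, up to sign, the determinant of the two other columns and [X];
    division by the length of [X] gives the area spanned by their projections. *)
Definition area X w (k : 'I_3) : R := w k / enorm X.

Lemma det3_distinct G a b c : G \in unitmx -> distinct3 a b c ->
  det3 (rcol R G a) (rcol R G b) (rcol R G c) ^+ 2 = 1.
Proof.
move=> uG.
have h : det3 (rcol R G 0) (rcol R G 1) (rcol R G 2) ^+ 2 = 1.
  by rewrite det3_rcol; move: uG; rewrite unitmxE => /orP[] /eqP ->;
    rewrite ?sqrrN expr1n.
have K k : [\/ k = 0, k = 1 | k = 2] := @distinct3_cases 0 1 2 k isT.
case: (K a) => ->; case: (K b) => ->; case: (K c) => -> // _;
  rewrite -h /det3; ring.
Qed.

Lemma det3_state X G w a b c : X = \sum_k w k *: rcol R G k -> distinct3 a b c ->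
  det3 (rcol R G a) (rcol R G b) X =
  w c * det3 (rcol R G a) (rcol R G b) (rcol R G c).
Proof.
move=> eX d; rewrite (sum_distinct3 _ d) in eX.
have e m : X m 0 = w a * rcol R G a m 0 + w b * rcol R G b m 0 + w c * rcol R G c m 0.
  by rewrite {1}eX !mxE.
by rewrite /det3 !e; ring.
Qed.

Lemma state_planar X G w : X != 0 -> state X G w -> planar (rproj X G) (area X w).
Proof.
move=> X0 [uG eX w0 x0] a b c d.
have n0 : 0 < dot X X by rewrite lt_def dot_eq0 X0 dot_ge0.
have nn : enorm X ^+ 2 = dot X X by rewrite enorm_sqr.
have n0' : enorm X != 0 by rewrite -sqrf_eq0 nn gt_eqF.
have dd := det3_distinct uG d.
have db : distinct3 a c b by case/and3P: d => ? ? ?; apply/and3P; split; rewrite // eq_sym.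
have e1 := det3_state eX d.
(* The exchange of two columns yields the minus sign that places the origin inside the triangle. *)
have e2 : det3 (rcol R G a) (rcol R G c) X =
    - (w b * det3 (rcol R G a) (rcol R G b) (rcol R G c)).
  by rewrite (det3_state eX db) /det3; ring.
split.
- by rewrite divr_gt0 // lt_def n0' enorm_ge0.
- rewrite /rproj gram_projP // e1 -nn expr2 /area.
  rewrite (_ : _ / _ = det3 (rcol R G a) (rcol R G b) (rcol R G c) ^+ 2 *
    (w c / enorm X) ^+ 2); last by field.
  by rewrite dd mul1r.
rewrite /rproj gram_projP // e1 e2 -nn /area.
rewrite (_ : _ / _ = det3 (rcol R G a) (rcol R G b) (rcol R G c) ^+ 2 *
    - (w b / enorm X * (w c / enorm X))); last by field.
by rewrite dd mul1r.
Qed.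

Lemma rcol_sub G j i k :
  rcol R (sub_col j i G) k = if k == j then rcol R G j - rcol R G i else rcol R G k.
Proof.
by apply/colP => m; case: eqP => [->|/eqP kj]; rewrite !mxE ?eqxx ?(negPf kj) ?rmorphB.
Qed.

Lemma rproj_sub X G j i : rproj X (sub_col j i G) = sub_vec (rproj X G) j i.
Proof.
apply/funext => k; rewrite /rproj /sub_vec rcol_sub; case: eqP => // _.
exact: projPB.
Qed.

Lemma xval_sub X G j i k :
  xval X (sub_col j i G) k = if k == j then xval X G j - xval X G i else xval X G k.
Proof. by rewrite /xval rcol_sub; case: eqP => // _; rewrite dotBl. Qed.

Lemma area_add X w j i : area X (add_area w j i) = add_area (area X w) j i.
Proof.
by apply/funext => k; rewrite /area /add_area; case: eqP => // _; rewrite mulrDl.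
Qed.

Lemma sub_colE G j i : i != j -> sub_col j i G = G *m (1%:M - delta_mx i j).
Proof.
move=> ij; apply/matrixP => k l; rewrite mulmxBr mulmx1 !mxE.
rewrite (bigD1 i) //= big1 ?addr0; last by move=> m mi; rewrite !mxE (negPf mi) mulr0.
by rewrite !mxE eqxx; case: (eqVneq l j) => [->|]; rewrite ?mulr1 ?mulr0 ?subr0.
Qed.

Lemma sub_col_unit G j i : i != j -> G \in unitmx -> sub_col j i G \in unitmx.
Proof.
move=> ij uG; rewrite sub_colE // unitmx_mul uG /=.
have /mulmx1_unit[] : (1%:M - delta_mx i j) *m (1%:M + delta_mx i j) = 1%:M :> 'M[int]_3.
  rewrite mulmxBl mul1mx mulmxDr mulmx1 mul_delta_mx_0 1?eq_sym //.
  by rewrite addr0 addrK.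
by [].
Qed.

(** With [g] for the columns, [w_j g_j = w_j (g_j - g_i) + w_j g_i], so the coordinate at [i] grows
    by [w_j] and all coordinates stay positive. *)
Lemma state_sub X G w j i : state X G w -> i != j -> xval X G i < xval X G j ->
  state X (sub_col j i G) (add_area w j i).
Proof.
move=> [uG eX w0 x0] ij xij; split.
- exact: sub_col_unit.
- have [k d] := third_index ij; case/and3P: (d) => _ jk ik.
  rewrite eX !(sum_distinct3 _ d) /add_area !rcol_sub !eqxx (negPf ij).
  rewrite [j == i]eq_sym (negPf ij) [k == i]eq_sym [k == j]eq_sym (negPf ik) (negPf jk).
  congr (_ + _); move: (rcol R G i) (rcol R G j) => u v.
  by apply/colP => m; rewrite !mxE; ring.
- by move=> k; rewrite /add_area; case: eqP => // _; rewrite addr_gt0.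
- by move=> k; rewrite xval_sub; case: eqP => // _; rewrite subr_gt0.
Qed.

Lemma rcol_perm G (s : 'S_3) k : rcol R (col_perm s G) k = rcol R G (s k).
Proof. by apply/colP => m; rewrite !mxE. Qed.

Lemma state_perm X G w (s : 'S_3) : state X G w ->
  state X (col_perm s G) (fun k => w (s k)).
Proof.
move=> [uG eX w0 x0]; split => //.
- by rewrite col_permE unitmx_mul uG unitmx_perm.
- rewrite eX (reindex_inj (@perm_inj _ s)) /=.
  by apply: eq_bigr => k _; rewrite rcol_perm.
- by move=> k; rewrite /xval rcol_perm; apply: x0.
Qed.

Lemma distinct3_perm (s : 'S_3) a b c : distinct3 a b c -> distinct3 (s a) (s b) (s c).
Proof. by rewrite /distinct3 !(inj_eq perm_inj). Qed.

Lemma fat_perm c0 (r : 'I_3 -> 'cV[R]_3) v (s : 'S_3) : fat c0 r v ->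
  fat c0 (fun k => r (s k)) (fun k => v (s k)).
Proof.
have eL : area_bound c0 (fun k => v (s k)) = area_bound c0 v.
  by rewrite /area_bound [in RHS](reindex_inj (@perm_inj _ s)).
case=> [h|[a [b [c [l [be [d h1 h2 h3 h4]]]]]]]; [left|right].
  by move=> k; rewrite eL.
exists (s^-1 a)%g, (s^-1 b)%g, (s^-1 c)%g, l, be.
by split; rewrite ?permKV ?eL //; apply: distinct3_perm.
Qed.

End States.

(** * The invariant along a run *)

Section Run.
Variables (R : realType) (X : 'cV[R]_3) (G : nat -> 'M[int]_3).
Hypothesis ratX : rat_independent X.
Hypothesis posX : pos_increasing X.
Hypothesis runG : sva_run X G.

Lemma int_independent (g : 'cV[int]_3) : dot (map_mx intr g) X = 0 -> g = 0.
Proof.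
move=> h; have h2 : forall i, (g i 0)%:~R = 0 :> rat.
  apply: ratX; rewrite -[RHS]h; apply: eq_bigr => i _.
  by rewrite ratr_int mxE.
by apply/colP => i; rewrite mxE; apply/eqP; rewrite -(intr_eq0 rat) h2.
Qed.

Lemma X_neq0 : X != 0.
Proof.
by apply/eqP => X0; case: posX => h _ _; move: h; rewrite X0 mxE ltxx.
Qed.

Lemma normX_gt0 : 0 < dot X X.
Proof. by rewrite lt_def dot_eq0 X_neq0 dot_ge0. Qed.

Lemma enormX_gt0 : 0 < enorm X.
Proof. by rewrite sqrtr_gt0 normX_gt0. Qed.

Lemma enorm_projD h : enorm (projD X h) = `|dot h X| / enorm X.
Proof.
rewrite /projD {1}/enorm dotZl dotZr mulrA -expr2 sqrtrM ?sqr_ge0 // sqrtr_sqr.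
rewrite -/(enorm X) normrM normfV (gtr0_norm normX_gt0) -(enorm_sqr X).
by have := enormX_gt0 => /gt_eqF h0; field; rewrite h0.
Qed.

Lemma cofactor_vecE s i : cofactor_vec X G s i 0 = `|xval X (G s) i|.
Proof.
rewrite mxE enorm_projD mulrC divfK //; apply: lt0r_neq0; exact: enormX_gt0.
Qed.

Lemma proj_dist_sqr F j i : proj_dist X F j i ^+ 2 =
  dot (rproj X F j - rproj X F i) (rproj X F j - rproj X F i).
Proof. exact: enorm_sqr. Qed.

Definition sorted_vals F := xval X F 0 < xval X F 1 /\ xval X F 1 < xval X F 2.

(** Equal values would give an integer relation between the coordinates of [X]. Thus sorted values
    increase strictly, and subtraction keeps them positive. *)
Lemma xval_neq F i j : F \in unitmx -> i != j -> xval X F i != xval X F j.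
Proof.
move=> uF ij; apply/eqP => e.
have : col i F - col j F = 0.
  by apply: int_independent; rewrite map_mxB dotBl; apply/eqP; rewrite subr_eq0; apply/eqP.
move/eqP; rewrite subr_eq0 => /eqP/(congr1 (mulmx (invmx F))).
rewrite !colE !mulmxA mulVmx // !mul1mx => /colP/(_ i).
by rewrite !mxE eqxx (negPf ij).
Qed.

(** The three distances in the rule are those of all pairs of columns, and the column with the
    smaller value is always the one subtracted. *)
Lemma sva_step_cases F F' w : state X F w -> sorted_vals F -> sva_step X F F' ->
  exists j i (s : 'S_3), [/\ i != j, xval X F i < xval X F j,
    closest (rproj X F) j i & F' = col_perm s (sub_col j i F)].
Proof.
move=> st [s01 s12] [H [sub [s ->] _]].
have clo j i : proj_dist_min X F = proj_dist X F j i -> closest (rproj X F) j i.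
  move=> e l m lm; rewrite -!proj_dist_sqr -e ler_sqr ?nnegrE; last first.
  - exact: enorm_ge0.
  - by rewrite e; exact: enorm_ge0.
  have pC a b : proj_dist X F a b = proj_dist X F b a.
    by rewrite /proj_dist /enorm dot_distC.
  rewrite /proj_dist_min {e}; move: (proj_dist X F) pC => pd pC.
  have K k : [\/ k = 0, k = 1 | k = 2] := @distinct3_cases 0 1 2 k isT.
  rewrite !ge_min; case: (K l) lm => ->; case: (K m) => -> // _; rewrite ?lexx ?orbT //.
  - by rewrite (pC 0) lexx.
  - by rewrite (pC 0) lexx !orbT.
  - by rewrite (pC 1 2) lexx orbT.
by case: sub => -[/clo c ->]; [exists 1, 0, s | exists 2, 1, s | exists 2, 0, s];
  split => //; apply: lt_trans s12.
Qed.

Lemma sva_step_sorted F F' w : state X F' w -> sva_step X F F' -> sorted_vals F'.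
Proof.
move=> [uF _ _ x0] [H [_ _]].
rewrite !enorm_projD !ler_pM2r ?invr_gt0 ?enormX_gt0 // => /andP[].
rewrite !(gtr0_norm (x0 _)) => h1 h2.
by split; rewrite lt_neqAle ?h1 ?h2 andbT; apply: xval_neq.
Qed.

(** The constant [c0] of the run: it dominates the squared lengths of the initial projections, so
    that the initial state is fat. *)
Definition start_bound : R := \sum_k dot (rproj X 1%:M k) (rproj X 1%:M k).

Lemma start_bound_ge0 : 0 <= start_bound.
Proof. by apply: sumr_ge0 => k _; apply: dot_ge0. Qed.

Lemma xval1 k : xval X 1%:M k = X k 0.
Proof.
rewrite /xval /dot (bigD1 k) //= big1 ?addr0.
  by rewrite !mxE eqxx mul1r.
by move=> i ik; rewrite !mxE (negPf ik) mul0r.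
Qed.

Lemma run_state s : exists w, [/\ state X (G s) w, sorted_vals (G s) &
  fat start_bound (rproj X (G s)) (area X w)].
Proof.
elim: s => [|s [w [st so ft]]].
  case: posX => p0 p1 p2; have [-> _] := runG; exists (fun k => X k 0).
  have xp k : 0 < X k 0.
    by have [->|->|->] := @distinct3_cases 0 1 2 k isT; lra.
  have st : state X 1%:M (fun k => X k 0).
    split => //; first exact: unitmx1; last by move=> k; rewrite xval1.
    apply/colP => m; rewrite summxE (bigD1 m) //= big1 ?addr0.
      by rewrite !mxE eqxx mulr1.
    by move=> k km; rewrite !mxE eq_sym (negPf km) mulr0.
  split => //; first by rewrite /sorted_vals !xval1.
  left => k; have pl := state_planar X_neq0 st.
  apply: (@le_trans _ _ start_bound).
    rewrite /start_bound (bigD1 k) //= lerDl; apply: sumr_ge0 => i _; exact: dot_ge0.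
  rewrite lerDr mulr_ge0 //; apply: sumr_ge0 => i _; apply: ltW.
  exact: planar_gt0 pl.
have [_ /(_ s) stp] := runG.
have [j [i [sg [ij xij cl e]]]] := sva_step_cases st so stp.
have st' : state X (G s.+1) (fun k => add_area w j i (sg k)).
  by rewrite e; apply: state_perm; apply: state_sub.
exists (fun k => add_area w j i (sg k)); split => //.
  exact: (sva_step_sorted st' stp).
have ft' := fat_step (state_planar X_neq0 st) start_bound_ge0 ft ij cl.
rewrite -rproj_sub -area_add in ft'.
have := fat_perm sg ft'.
congr (fat _ _ _); apply/funext => k.
by rewrite e /rproj rcol_perm.
Qed.

End Run.

(** * Eigenvectors with rationally independent coordinates *)

Definition krylov (F : fieldType) (u : 'rV[F]_3) (B : 'M[F]_3) : 'M[F]_3 :=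
  \matrix_(k < 3) (u *m B ^+ k).

Lemma krylov_combination (F : fieldType) (u c : 'rV[F]_3) (B : 'M[F]_3) :
  c *m krylov u B = u *m horner_mx B (rVpoly c).
Proof.
rewrite [rVpoly c]poly_def rmorph_sum /= mulmx_sumr.
apply/rowP => j; rewrite mxE summxE; apply: eq_bigr => k _.
rewrite -mul_polyC rmorphM rmorphXn /= horner_mx_C horner_mx_X.
by rewrite -mulmxE mul_scalar_mx -scalemxAr !mxE valK.
Qed.

(** A relation between the rows reads [u *m p(B) = 0] with [p] of degree at most 2. A nonzero [p] is
    coprime to [P], so Bezout makes [p(B)] invertible and [u] zero. *)
Lemma krylov_unit (F : fieldType) (P : {poly F}) (u : 'rV[F]_3) (B : 'M[F]_3) :
  irreducible_poly P -> size P = 4 -> horner_mx B P = 0 -> u != 0 ->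
  krylov u B \in unitmx.
Proof.
move=> irr sP PB u0; rewrite -row_free_unit; apply: inj_row_free => c.
rewrite krylov_combination => h.
have [c0|cn0] := eqVneq (rVpoly c) 0.
  by rewrite -(rVpolyK c) c0 linear0.
have cop : coprimep P (rVpoly c).
  rewrite irreducible_poly_coprime //; apply/negP => /(dvdp_leq cn0).
  by rewrite sP leqNgt ltnS size_poly.
have /Bezout_eq1_coprimepP[[p q] /= e] := cop.
case/eqP: u0; rewrite -(mulmx1 u) -[1%:M](rmorph1 (horner_mx B)) -e.
rewrite rmorphD !rmorphM /= PB mulr0 add0r.
by rewrite (comm_horner_mx2 B q (rVpoly c)) -mulmxE mulmxA h mul0mx.
Qed.

Lemma char_poly_trmx (F : comNzRingType) n (A : 'M[F]_n) :
  char_poly A^T = char_poly A.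
Proof.
rewrite /char_poly -[RHS]det_tr; congr (\det _).
by apply/matrixP => i j; rewrite !mxE eq_sym.
Qed.

Section Eigen.
Variable R : realType.
Local Notation rmx := (map_mx (ratr : rat -> R)).
Implicit Types (X Y : 'cV[R]_3) (B N C : 'M[rat]_3) (mu nu t : R).

Definition powers mu : 'cV[R]_3 := \col_k mu ^+ k.

Lemma qeval_rVpoly (c : 'rV[rat]_3) mu : qeval (rVpoly c) mu = (rmx c *m powers mu) 0 0.
Proof.
rewrite /qeval [rVpoly c]poly_def rmorph_sum /= horner_sum mxE.
apply: eq_bigr => k _; rewrite map_polyZ map_polyXn hornerZ hornerXn !mxE.
by rewrite valK.
Qed.

Lemma expr_eigen B Y mu k : rmx B *m Y = mu *: Y -> rmx (B ^+ k) *m Y = mu ^+ k *: Y.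
Proof.
move=> e; elim: k => [|k IH]; first by rewrite !expr0 map_mx1 mul1mx scale1r.
by rewrite exprSr map_mxM -mulmxA e -scalemxAr IH scalerA exprS.
Qed.

Lemma horner_eigen B Y mu (p : {poly rat}) : rmx B *m Y = mu *: Y ->
  rmx (horner_mx B p) *m Y = qeval p mu *: Y.
Proof.
move=> e; rewrite /qeval -{1 2}[p]coefK poly_def !rmorph_sum /= horner_sum.
rewrite mulmx_suml scaler_suml; apply: eq_bigr => k _.
have -> : horner_mx B (p`_k *: 'X^k) = p`_k *: B ^+ k.
  by rewrite horner_mxZ rmorphXn /= horner_mx_X.
rewrite map_mxZ -scalemxAl (expr_eigen _ e) scalerA.
by rewrite map_polyZ map_polyXn hornerZ hornerXn.
Qed.

Lemma krylov_eigen u B Y mu : rmx B *m Y = mu *: Y ->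
  rmx (krylov u B) *m Y = (rmx u *m Y) 0 0 *: powers mu.
Proof.
move=> e; apply/colP => k.
have -> : (rmx (krylov u B) *m Y) k 0 = (row k (rmx (krylov u B) *m Y)) 0 0.
  by rewrite [RHS]mxE.
rewrite row_mul -map_row rowK map_mxM -mulmxA (expr_eigen _ e) -scalemxAr !mxE.
by rewrite mulrC.
Qed.

(** The eigenvalue and the single number [u Y] determine the eigenvector. This expresses [X] by
    powers of its eigenvalue and makes eigenvectors of a common matrix proportional. *)
Lemma eigen_powers u B Y mu : krylov u B \in unitmx -> rmx B *m Y = mu *: Y ->
  Y = (rmx u *m Y) 0 0 *: (rmx (invmx (krylov u B)) *m powers mu).
Proof.
move=> uK e; rewrite scalemxAr -(krylov_eigen u e) mulmxA -map_mxM mulVmx //.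
by rewrite map_mx1 mul1mx.
Qed.

(** In the basis given by [C] the eigenvector becomes [powers mu], whose first entry is 1; the first
    row of the eigenvalue equation then writes [nu] as a polynomial in [mu]. *)
Lemma eigenvalue_Qadjoin C N Y mu nu t : t != 0 -> C \in unitmx ->
  Y = t *: (rmx C *m powers mu) -> rmx N *m Y = nu *: Y -> Qadjoin mu nu.
Proof.
move=> t0 uC eY e; exists (rVpoly (row 0 (invmx C *m N *m C))).
have e1 : rmx N *m (rmx C *m powers mu) = nu *: (rmx C *m powers mu).
  apply: (scalerI t0); rewrite scalerA mulrC -scalerA -eY -e eY.
  by rewrite -scalemxAr.
have e2 : rmx (invmx C *m N *m C) *m powers mu = nu *: powers mu.
  rewrite !map_mxM -!mulmxA e1 -scalemxAr mulmxA -map_mxM mulVmx //.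
  by rewrite map_mx1 mul1mx.
by rewrite qeval_rVpoly map_row -row_mul e2 !mxE expr0 mulr1.
Qed.

Lemma Qadjoin_sub mu nu : Qadjoin mu nu -> (Qadjoin nu `<=` Qadjoin mu)%classic.
Proof.
move=> [q ->] y [p ->]; exists (p \Po q).
by rewrite /qeval map_comp_poly horner_comp.
Qed.

Lemma rat_independent_mx X N : rat_independent X -> rmx N *m X = 0 -> N = 0.
Proof.
move=> rX h; apply/matrixP => i j; rewrite [RHS]mxE.
apply: (rX (fun j => N i j)).
have /colP/(_ i) := h; rewrite !mxE => e; rewrite -[RHS]e.
by apply: eq_bigr => k _; rewrite mxE.
Qed.

Lemma rat_independent_neq0 X : rat_independent X -> X != 0.
Proof.
move=> rX; apply/eqP => X0.
have := rX (fun=> 1); rewrite X0 big1 => [/(_ erefl 0)/eqP|i _].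
  by rewrite oner_eq0.
by rewrite mxE mulr0.
Qed.

Lemma char_poly_eigen X B mu : rat_independent X -> rmx B *m X = mu *: X ->
  qeval (char_poly B) mu = 0.
Proof.
move=> rX e; have := horner_eigen (char_poly B) e.
rewrite Cayley_Hamilton map_mx0 mul0mx => /esym/eqP.
by rewrite scaler_eq0 (negPf (rat_independent_neq0 rX)) orbF => /eqP.
Qed.

(** A reducible cubic has a rational root [q], with a rational left eigenvector [v]. Evaluating
    [v B X] in two ways gives [mu = q], as [v X] is nonzero by independence; then [(B - q) X = 0]
    forces [B] to be scalar. *)
Lemma char_poly_irreducible X B mu : rat_independent X -> rmx B *m X = mu *: X ->
  (forall q : rat, B <> q%:M) -> irreducible_poly (char_poly B).
Proof.
move=> rX e nB; apply: cubic_irreducible; first by rewrite size_char_poly.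
move=> q; apply/negP; rewrite -eigenvalue_root_char => /eigenvalueP[v ev v0].
have vX : (rmx v *m X) 0 0 != 0.
  apply: contra v0 => /eqP h; apply/eqP/rowP => j; rewrite [RHS]mxE.
  apply: (rX (fun j => v 0 j)); rewrite -[RHS]h mxE.
  by apply: eq_bigr => k _; rewrite mxE.
have emu : mu = ratr q.
  apply: (mulIf vX).
  have : (rmx v *m (rmx B *m X)) 0 0 = (rmx (v *m B) *m X) 0 0.
    by rewrite map_mxM mulmxA.
  by rewrite e ev -scalemxAr map_mxZ -scalemxAl !mxE.
apply: (nB q); apply/eqP; rewrite -subr_eq0; apply/eqP.
apply: (rat_independent_mx rX); rewrite map_mxB mulmxBl e emu map_scalar_mx.
by rewrite mul_scalar_mx subrr.
Qed.

Lemma char_poly_algebraic_integer X (M : 'M[int]_3) mu : rat_independent X ->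
  map_mx intr M *m X = mu *: X -> algebraic_integer mu.
Proof.
move=> rX e; exists (char_poly M); first exact: char_poly_monic.
have e2 : rmx (map_mx intr M) *m X = mu *: X.
  rewrite -e; congr (_ *m _); apply/matrixP => i j; by rewrite !mxE ratr_int.
have := char_poly_eigen rX e2.
rewrite /qeval -map_char_poly -map_poly_comp /root => h; apply/eqP.
rewrite -[RHS]h; congr (_.[_]); apply: eq_map_poly => z.
by rewrite /= ratr_int.
Qed.

End Eigen.

(** * Consequences of a loop *)

Section Loop.
Variables (R : realType) (X : 'cV[R]_3) (G : nat -> 'M[int]_3).
Hypothesis ratX : rat_independent X.
Hypothesis posX : pos_increasing X.
Hypothesis runG : sva_run X G.

Lemma run_unit s : G s \in unitmx.
Proof. by have [w [[]]] := run_state ratX posX runG s. Qed.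

Lemma run_xval_gt0 s k : 0 < xval X (G s) k.
Proof. by have [w [[]]] := run_state ratX posX runG s. Qed.

Lemma run_step s : exists j i (sg : 'S_3),
  [/\ i != j, xval X (G s) i < xval X (G s) j, closest (rproj X (G s)) j i &
      G s.+1 = col_perm sg (sub_col j i (G s))].
Proof.
have [w [st so _]] := run_state ratX posX runG s.
by apply: sva_step_cases st so _; have [_] := runG.
Qed.

(** Each step subtracts a positive cofactor. This gives [lambda < 1] in a loop and forbids the
    repetition of a matrix. *)
Lemma run_sum_decreasing s p : (0 < p)%N ->
  \sum_k xval X (G (s + p)) k < \sum_k xval X (G s) k.
Proof.
have step n : \sum_k xval X (G n.+1) k < \sum_k xval X (G n) k.
  have [j [i [sg [ij xij _ ->]]]] := run_step n.
  have -> : \sum_k xval X (col_perm sg (sub_col j i (G n))) k =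
            \sum_k xval X (sub_col j i (G n)) k.
    rewrite [RHS](reindex_inj (@perm_inj _ sg)) /=.
    by apply: eq_bigr => k _; rewrite /xval rcol_perm.
  have [k d] := third_index ij; rewrite !(sum_distinct3 _ d) !xval_sub eqxx.
  case/and3P: d => _ jk ik.
  rewrite (negPf ij) [k == j]eq_sym (negPf jk).
  by have := run_xval_gt0 n i; lra.
case: p => // p _; elim: p => [|p IH]; first by rewrite addn1.
by rewrite addnS; apply: lt_trans (step _) IH.
Qed.

Definition xvec (F : 'M[int]_3) : 'cV[R]_3 := (map_mx intr F)^T *m X.

Lemma xvecE F k : xvec F k 0 = xval X F k.
Proof. by rewrite mxE; apply: eq_bigr => i _; rewrite !mxE. Qed.

Lemma cofactor_xvec s : cofactor_vec X G s = xvec (G s).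
Proof.
by apply/colP => k; rewrite cofactor_vecE // xvecE gtr0_norm ?run_xval_gt0.
Qed.

Lemma cofactor_proportional s p :
  (exists lambda : R, cofactor_vec X G (s + p) = lambda *: cofactor_vec X G s) <->
  cofactor_ratios X G (s + p) = cofactor_ratios X G s.
Proof.
rewrite /cofactor_ratios !cofactor_xvec !xvecE.
have n0 m k : xval X (G m) k != 0 by apply: lt0r_neq0; apply: run_xval_gt0.
split => [[la /colP e]|[e0 e1]].
  have e' k : xval X (G (s + p)) k = la * xval X (G s) k by rewrite -!xvecE e mxE.
  have la0 : la != 0.
    by apply: contraNneq (n0 (s + p)%N 0) => la0; rewrite e' la0 mul0r.
  by rewrite !e'; congr (_, _); field; rewrite la0 n0.
exists (xval X (G (s + p)) 2 / xval X (G s) 2); apply/colP => k.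
rewrite [RHS]mxE !xvecE.
have -> : forall a b c : R, a / b * c = a * (c / b) by move=> *; ring.
have [->|->|->] := @distinct3_cases 0 1 2 k isT.
- by rewrite -e0 mulrC divfK.
- by rewrite -e1 mulrC divfK.
- by rewrite divff // mulr1.
Qed.

(** Cofactors are positive, so the cofactor vector is [G^T X], and the quotient of the two
    unimodular transposes has [X] as an eigenvector. *)
Lemma loop_matrix s p lambda : (0 < p)%N ->
  cofactor_vec X G (s + p) = lambda *: cofactor_vec X G s ->
  [/\ 0 < lambda, lambda < 1 & exists M : 'M[int]_3,
     M \in unitmx /\ map_mx intr M *m X = lambda *: X].
Proof.
rewrite !cofactor_xvec => p0 e.
have e' k : xval X (G (s + p)) k = lambda * xval X (G s) k.
  by rewrite -!xvecE e mxE.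
have l0 : 0 < lambda.
  by have := run_xval_gt0 (s + p) 0; rewrite e' pmulr_lgt0 // run_xval_gt0.
split => //.
  have := run_sum_decreasing s p0.
  rewrite (eq_bigr (fun k => lambda * xval X (G s) k)) => [|k _]; last exact: e'.
  rewrite -mulr_sumr gtr_pMl // (bigD1 0) //= ltr_wpDr ?run_xval_gt0 //.
  by apply: sumr_ge0 => k _; apply: ltW; apply: run_xval_gt0.
exists (invmx (G s)^T *m (G (s + p))^T); split.
  by rewrite unitmx_mul unitmx_inv !unitmx_tr !run_unit.
rewrite map_mxM -mulmxA -map_trmx -/(xvec _) e -scalemxAr /xvec mulmxA.
rewrite map_trmx -map_mxM mulVmx ?unitmx_tr ?run_unit //.
by rewrite map_mx1 mul1mx.
Qed.

Lemma loop_conclusion s p lambda : (0 < p)%N ->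
  cofactor_vec X G (s + p) = lambda *: cofactor_vec X G s ->
  [/\ algebraic_integer lambda, algebraic_degree lambda 3, algebraic_unit lambda,
    exists C N : 'M[rat]_3, [/\ C \in unitmx,
      X = X 2 0 *: (map_mx ratr C *m powers lambda) &
      map_mx ratr N *m X = lambda *: X] &
    rational_function_of lambda (X 0 0 / X 2 0) /\
    rational_function_of lambda (X 1 0 / X 2 0)].
Proof.
move=> p0 /(loop_matrix p0)[l0 l1 [M [uM eM]]].
have iM := char_poly_algebraic_integer ratX eM.
pose N : 'M[rat]_3 := map_mx intr M.
have eN : map_mx ratr N *m X = lambda *: X.
  rewrite -eM; congr (_ *m _); apply/matrixP => i j; by rewrite !mxE ratr_int.
(* A scalar matrix would make [lambda] an integer strictly between 0 and 1. *)
have nN (q : rat) : N <> q%:M.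
  move=> Nq; have e : lambda = ratr q.
    move: eN; rewrite Nq map_scalar_mx mul_scalar_mx => /colP/(_ 2).
    rewrite !mxE => /mulIf -> //; apply: lt0r_neq0.
    by case: posX => *; lra.
  have e2 : q = (M 0 0)%:~R.
    by have /matrixP/(_ 0 0) := Nq; rewrite !mxE eqxx mulr1n.
  move: l0 l1; rewrite e e2 ratr_int ltr0z -[1]/(1%:~R) ltr_int.
  by rewrite gtz0_ge1 => h1 /(le_lt_trans h1); rewrite ltxx.
have irr := char_poly_irreducible ratX eN nN.
(* This row selects the last coordinate, so that [X] comes out normalized by [X 2 0]. *)
pose u : 'rV[rat]_3 := delta_mx 0 2.
have uX : (map_mx ratr u *m X) 0 0 = X 2 0.
  by rewrite map_delta_mx -rowE mxE.
have uK : krylov u N \in unitmx.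
  apply: (krylov_unit irr); first by rewrite size_char_poly.
    exact: Cayley_Hamilton.
  by apply/eqP => /rowP/(_ 2)/eqP; rewrite !mxE eqxx oner_eq0.
have eX := eigen_powers uK eN; rewrite uX in eX.
have X2 : X 2 0 != 0 by apply: lt0r_neq0; case: posX => *; lra.
have rf k : rational_function_of lambda (X k 0 / X 2 0).
  exists (rVpoly (row k (invmx (krylov u N)))), 1; split.
    by rewrite /qeval rmorph1 hornerC; apply/eqP; rewrite oner_eq0.
  rewrite /qeval rmorph1 hornerC divr1 -/(qeval _ _) qeval_rVpoly.
  by rewrite {1}eX map_row -row_mul !mxE mulrAC divff ?mul1r.
split => //.
- by exists (char_poly N); rewrite size_char_poly (char_poly_eigen ratX eN).
(* The inverse of [lambda] is an eigenvalue of the integer matrix [invmx M]. *)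
- split => //; exists lambda^-1; rewrite divff ?gt_eqF //; split => //.
  apply: (char_poly_algebraic_integer (M := invmx M) ratX).
  apply: (scalerI (lt0r_neq0 l0)); rewrite scalerA divff ?gt_eqF // scale1r.
  by rewrite scalemxAr -eM mulmxA -map_mxM mulVmx // map_mx1 mul1mx.
by exists (invmx (krylov u N)), N; rewrite unitmx_inv.
Qed.

End Loop.

(** * Cubic vectors are badly approximable *)

Section CubicMultiplication.
Variables (R : realType) (P : {poly rat}) (rho : R) (X : 'cV[R]_3).
Hypothesis irrP : irreducible_poly P.
Hypothesis sizeP : size P = 4.
Hypothesis rootP : qeval P rho = 0.
Hypothesis ratX : rat_independent X.
Hypothesis adjX : forall i, Qadjoin rho (X i 0).
Local Notation rmx := (map_mx (ratr : rat -> R)).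

Lemma qeval_modp (p : {poly rat}) :
  qeval p rho = (rmx (poly_rV (p %% P) : 'rV_3) *m powers rho) 0 0.
Proof.
rewrite -qeval_rVpoly poly_rV_K; last first.
  by rewrite -ltnS (leq_trans (_ : _ < size P)%N) ?ltn_modp ?irredp_neq0 // sizeP.
rewrite {1}(divp_eq p P) /qeval rmorphD rmorphM /= hornerD hornerM.
by rewrite -/(qeval P rho) rootP mulr0 add0r.
Qed.

(** The rows of [C] are remainders modulo [P]; a relation between them would be a rational relation
    between the coordinates of [X]. *)
Lemma coordinates_powers :
  exists C : 'M[rat]_3, C \in unitmx /\ X = rmx C *m powers rho.
Proof.
have [p hp] := choice adjX.
pose C : 'M[rat]_3 := \matrix_i (poly_rV (p i %% P) : 'rV_3).
have eX : X = rmx C *m powers rho.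
  apply/colP => i; rewrite hp qeval_modp.
  have -> : (rmx C *m powers rho) i 0 = (row i (rmx C *m powers rho)) 0 0.
    by rewrite [RHS]mxE.
  by rewrite row_mul -map_row rowK.
exists C; split => //; rewrite -row_free_unit; apply: inj_row_free => c cC.
apply/rowP => j; rewrite [RHS]mxE; apply: (ratX (q := fun j => c 0 j)).
have : (rmx c *m X) 0 0 = 0 by rewrite eX mulmxA -map_mxM cC map_mx0 mul0mx mxE.
by rewrite mxE => e; rewrite -[RHS]e; apply: eq_bigr => k _; rewrite mxE.
Qed.

Lemma multiplication_matrix : exists A : 'M[rat]_3, rmx A *m X = rho *: X.
Proof.
have [C [uC eX]] := coordinates_powers.
(* Multiplication by [rho] on 1, [rho], [rho ^+ 2]; conjugation by [C] carries it over to the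
   coordinates of [X]. *)
pose S : 'M[rat]_3 := \matrix_(i < 3) (poly_rV ('X^(i.+1) %% P) : 'rV_3).
have eS : rmx S *m powers rho = rho *: powers rho.
  apply/colP => i.
  have -> : (rmx S *m powers rho) i 0 = (row i (rmx S *m powers rho)) 0 0.
    by rewrite [RHS]mxE.
  rewrite row_mul -map_row rowK -qeval_modp /qeval map_polyXn hornerXn.
  by rewrite !mxE exprS.
exists (C *m S *m invmx C); rewrite !map_mxM {1}eX -!mulmxA.
rewrite [rmx (invmx C) *m _]mulmxA -map_mxM mulVmx // map_mx1 mul1mx eS.
by rewrite -scalemxAr -eX.
Qed.

Lemma clear_denominators (A : 'M[rat]_3) : exists (d : int) (B : 'M[int]_3),
  d != 0 /\ map_mx intr B = d%:~R *: A.
Proof.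
pose d := \prod_(ij : 'I_3 * 'I_3) denq (A ij.1 ij.2).
pose e (ij : 'I_3 * 'I_3) := \prod_(kl | kl != ij) denq (A kl.1 kl.2).
exists d, (\matrix_(i, j) (numq (A i j) * e (i, j))); split.
  by apply/prodf_neq0 => ij _; apply: denq_neq0.
apply/matrixP => i j; rewrite !mxE /d (bigD1 (i, j)) //= -/(e (i, j)) !intrM.
by rewrite numqE; ring.
Qed.

(** The matrix of multiplication by [rho], cleared of denominators. It is not scalar, since [rho]
    would then be a rational root of the irreducible cubic [P]. *)
Lemma integer_eigenmatrix : exists (B : 'M[int]_3) (theta : R),
  map_mx intr B *m X = theta *: X /\
  irreducible_poly (char_poly (map_mx intr B : 'M[rat]_3)).
Proof.
have [A eA] := multiplication_matrix.
have [d [B [d0 eB]]] := clear_denominators A.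
have e : rmx (map_mx intr B) *m X = (d%:~R * rho) *: X.
  by rewrite eB map_mxZ -scalemxAl eA scalerA /= ratr_int.
exists B, (d%:~R * rho); split.
  rewrite -e; congr (_ *m _); apply/matrixP => i j; by rewrite !mxE ratr_int.
apply: (char_poly_irreducible ratX e) => q eq.
have er : rho = ratr (q / d%:~R).
  move: e; rewrite eq map_scalar_mx mul_scalar_mx => /eqP.
  rewrite -subr_eq0 -scalerBl scaler_eq0 (negPf (rat_independent_neq0 ratX)) orbF.
  rewrite subr_eq0 rmorphM fmorphV /= ratr_int => /eqP ->.
  by rewrite mulrAC divff ?mul1r // intr_eq0.
move: rootP; rewrite er /qeval horner_map => /eqP; rewrite fmorph_eq0 => rt.
have := apply_irredp irrP _ (_ : 'X - (q / d%:~R)%:P %| P).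
rewrite size_XsubC dvdp_XsubCl => /(_ isT rt)/eqp_size.
by rewrite size_XsubC sizeP.
Qed.

End CubicMultiplication.

Section EntryBounds.
Variable R : realType.
Implicit Types u v t X : 'cV[R]_3.

Lemma entry_le_enorm u k : `|u k 0| <= enorm u.
Proof.
rewrite -ler_sqr ?nnegrE ?enorm_ge0 // enorm_sqr real_normK ?num_real //.
rewrite /dot (bigD1 k) //= expr2 lerDl; apply: sumr_ge0 => i _.
by rewrite -expr2 sqr_ge0.
Qed.

Lemma mulmx_entry_bound (M : 'M[R]_3) : exists2 c : R, 0 <= c &
  forall u (m : R), (forall k, `|u k 0| <= m) -> forall k, `|(M *m u) k 0| <= c * m.
Proof.
exists (\sum_i \sum_j `|M i j|) => [|u m um k].
  by apply: sumr_ge0 => i _; apply: sumr_ge0.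
have m0 : 0 <= m by apply: le_trans (um 0).
apply: (@le_trans _ _ ((\sum_j `|M k j|) * m)).
  rewrite mxE mulr_suml; apply: le_trans (ler_norm_sum _ _ _) _.
  by apply: ler_sum => j _; rewrite normrM ler_wpM2l.
rewrite ler_wpM2r // [leRHS](bigD1 k) //= lerDl.
by apply: sumr_ge0 => i _; apply: sumr_ge0.
Qed.

Lemma det3_bound u v t (a b c : R) : (forall k, `|u k 0| <= a) ->
  (forall k, `|v k 0| <= b) -> (forall k, `|t k 0| <= c) ->
  `|det3 u v t| <= 6 * (a * b * c).
Proof.
move=> ua vb tc.
have h i j k : `|u i 0 * (v j 0 * t k 0)| <= a * b * c.
  by rewrite !normrM mulrA; do 2?[apply: ler_pM; rewrite ?mulr_ge0 //].
have := h 0 1 2; have := h 0 2 1; have := h 1 0 2; have := h 1 2 0.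
have := h 2 0 1; have := h 2 1 0; rewrite /det3 !mulrBr !ler_norml.
move=> /andP[a1 a2] /andP[b1 b2] /andP[c1 c2] /andP[d1 d2] /andP[e1 e2] /andP[f1 f2].
apply/andP; split; lra.
Qed.

(** The last row of the determinant is replaced by the combination of rows with coefficients from
    [X]. *)
Lemma det3_dot X u v t : X 2 0 * det3 u v t =
  u 0 0 * (v 1 0 * dot t X - dot v X * t 1 0) -
  u 1 0 * (v 0 0 * dot t X - dot v X * t 0 0) +
  dot u X * (v 0 0 * t 1 0 - v 1 0 * t 0 0) :> R.
Proof. by rewrite !dotE /det3; ring. Qed.

End EntryBounds.

(** * Lower bounds from nonzero integer determinants *)

Section BadApproximation.
Variables (R : realType) (X : 'cV[R]_3) (B : 'M[int]_3) (theta : R).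
Hypothesis X2 : 0 < X 2 0.
Hypothesis eigB : map_mx intr B *m X = theta *: X.
Hypothesis irrB : irreducible_poly (char_poly (map_mx intr B : 'M[rat]_3)).
Local Notation imx := (map_mx (intr : int -> R)).

(** The determinant is an integer, and it is nonzero because the three columns are the rows of an
    invertible Krylov matrix for the transpose of [M]. *)
Lemma krylov_det_ge1 (M : 'M[int]_3) (g : 'cV[int]_3) :
  irreducible_poly (char_poly (map_mx intr M : 'M[rat]_3)) -> g != 0 ->
  1 <= `|det3 (imx g) (imx M *m imx g) (imx M *m (imx M *m imx g))|.
Proof.
move=> irr g0.
pose K : 'M[int]_3 := \matrix_(i, k) (M ^+ k *m g) i 0.
have -> : det3 (imx g) (imx M *m imx g) (imx M *m (imx M *m imx g)) =
    det3 (rcol R K 0) (rcol R K 1) (rcol R K 2).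
  congr det3; apply/colP => i; rewrite rcolE [K _ _]mxE.
  - by rewrite [M ^+ _]expr0 mul1mx mxE.
  - by rewrite [M ^+ _]expr1 -map_mxM mxE.
  - by rewrite [M ^+ _]expr2 mulmxA -!map_mxM mxE.
rewrite det3_rcol -intr_norm -[1]/(1%:~R) ler_int -gtz0_ge1 normr_gt0.
have eK : map_mx (intr : int -> rat) K =
    (krylov (map_mx intr g)^T (map_mx intr M)^T)^T.
  apply/matrixP => i k; rewrite [LHS]mxE [RHS]mxE [K _ _]mxE.
  rewrite [RHS]mxE (_ : (map_mx intr M)^T ^+ k = (map_mx intr (M ^+ k))^T); last first.
    elim: (val k) => [|m IH]; first by rewrite !expr0 map_mx1 trmx1.
    by rewrite exprS IH exprSr -!mulmxE map_mxM trmx_mul.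
  by rewrite -trmx_mul -map_mxM !mxE.
suff : \det (map_mx (intr : int -> rat) K) != 0 by rewrite det_map_mx intr_eq0.
rewrite eK det_tr -unitfE -unitmxE.
apply: (krylov_unit (P := char_poly (map_mx intr M : 'M[rat]_3))) => //.
- by rewrite size_char_poly.
- by rewrite -char_poly_trmx Cayley_Hamilton.
apply: contra g0 => /eqP e; apply/eqP/colP => i.
have /rowP/(_ i) := e; rewrite !mxE => /eqP; rewrite intr_eq0 => /eqP //.
Qed.

(* The columns [g], [B^T g], [B^T^2 g] have a nonzero integral determinant, and
   [X] combines their rows into [(1, theta, theta ^+ 2)] times the value at [g]. *)
Lemma small_forms_bound : exists2 c : R, 0 < c & forall g : 'cV[int]_3, g != 0 ->
  c <= `|dot (imx g) X| * dot (imx g) (imx g).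
Proof.
have irrBt : irreducible_poly (char_poly (map_mx intr B^T : 'M[rat]_3)).
  by rewrite -map_trmx char_poly_trmx.
have eigBt u : dot (imx B^T *m u) X = theta * dot u X.
  have dotM (a b : 'cV[R]_3) : dot a b = (a^T *m b) 0 0.
    by rewrite mxE; apply: eq_bigr => i _; rewrite mxE.
  by rewrite !dotM trmx_mul map_trmx trmxK -mulmxA eigB -scalemxAr mxE.
have [c1 c10 h1] := mulmx_entry_bound (imx B^T).
(* A generous bound for the polynomial in [c1] and the size of [theta] that arises below, kept
   opaque behind an equation. *)
have [T [T0 eT]] : exists T, 0 < T /\ T = 4 * (1 + c1) ^+ 3 * (1 + `|theta|) ^+ 2.
  by eexists; split; last reflexivity; rewrite !mulr_gt0 ?exprn_gt0 // ltr_wpDr.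
exists (X 2 0 / (2 * T)); first by rewrite divr_gt0 // mulr_gt0.
move=> g g0; rewrite ler_pdivrMr ?mulr_gt0 //.
have := krylov_det_ge1 irrBt g0; rewrite -(ler_pM2l X2) mulr1.
rewrite -{2}(gtr0_norm X2) -normrM det3_dot !eigBt => /le_trans -> //.
set u := imx g; set v := imx B^T *m u; set t := imx B^T *m v.
set m := enorm u; have m0 : 0 <= m by exact: enorm_ge0.
have um := entry_le_enorm u; rewrite -/m in um.
have vm : forall k, `|v k 0| <= c1 * m := h1 _ _ um.
have tm : forall k, `|t k 0| <= c1 * (c1 * m) := h1 _ _ vm.
rewrite -enorm_sqr -/m.
(* Every term contains the value at [g]; the remaining factor is quadratic in the entries of [u],
   [v], [t], hence of order [m ^+ 2]. *)
have -> : u 0 0 * (v 1 0 * (theta * (theta * dot u X)) - theta * dot u X * t 1 0) -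
   u 1 0 * (v 0 0 * (theta * (theta * dot u X)) - theta * dot u X * t 0 0) +
   dot u X * (v 0 0 * t 1 0 - v 1 0 * t 0 0) =
   dot u X * (theta ^+ 2 * (u 0 0 * v 1 0) - theta * (u 0 0 * t 1 0)
     - theta ^+ 2 * (u 1 0 * v 0 0) + theta * (u 1 0 * t 0 0)
     + v 0 0 * t 1 0 - v 1 0 * t 0 0) by ring.
rewrite normrM -[leRHS]mulrA ler_wpM2l //.
have th0 : 0 <= `|theta| by [].
have hp (a b p q : R) : `|a| <= p -> `|b| <= q -> `|a * b| <= p * q.
  by move=> *; rewrite normrM ler_pM.
have ht (a p : R) k : `|a| <= p -> `|theta ^+ k * a| <= `|theta| ^+ k * p.
  by move=> h; rewrite normrM normrX ler_wpM2l // exprn_ge0.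
have e1 := ht _ _ 2 (hp _ _ _ _ (um 0) (vm 1)).
have e2 := ht _ _ 1 (hp _ _ _ _ (um 0) (tm 1)).
have e3 := ht _ _ 2 (hp _ _ _ _ (um 1) (vm 0)).
have e4 := ht _ _ 1 (hp _ _ _ _ (um 1) (tm 0)).
have e5 := hp _ _ _ _ (vm 0) (tm 1).
have e6 := hp _ _ _ _ (vm 1) (tm 0).
rewrite !expr1 in e2 e4.
apply: (@le_trans _ _ (2 * (m ^+ 2 * (`|theta| ^+ 2 * c1 + `|theta| * c1 ^+ 2 + c1 ^+ 3)))).
  move: e1 e2 e3 e4 e5 e6; rewrite !ler_norml.
  move=> /andP[a1 a2] /andP[b1 b2] /andP[d1 d2] /andP[f1 f2] /andP[k1 k2] /andP[l1 l2].
  by apply/andP; split; lra.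
rewrite [leRHS]mulrCA ler_pM2l ?ltr0n //; apply: ler_wpM2l; first exact: sqr_ge0.
rewrite eT; move: (`|theta|) th0 => th th0.
have : 0 <= c1 ^+ 2 by rewrite sqr_ge0.
have : 0 <= c1 ^+ 3 by rewrite exprn_ge0.
have : 0 <= th * c1 by rewrite mulr_ge0.
have : 0 <= th ^+ 2 * c1 by rewrite mulr_ge0 ?sqr_ge0.
have : 0 <= th * c1 ^+ 2 by rewrite mulr_ge0 ?sqr_ge0.
have : 0 <= th ^+ 2 * c1 ^+ 2 by rewrite mulr_ge0 ?sqr_ge0.
have : 0 <= th * c1 ^+ 3 by rewrite mulr_ge0 ?exprn_ge0.
have : 0 <= th ^+ 2 * c1 ^+ 3 by rewrite mulr_ge0 ?exprn_ge0.
have : 0 <= th ^+ 2 by rewrite sqr_ge0.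
have -> : 4 * (1 + c1) ^+ 3 * (1 + th) ^+ 2 = 4 * (1 + 3 * c1 + 3 * c1 ^+ 2 + c1 ^+ 3 +
  2 * th + 6 * (th * c1) + 6 * (th * c1 ^+ 2) + 2 * (th * c1 ^+ 3) +
  th ^+ 2 + 3 * (th ^+ 2 * c1) + 3 * (th ^+ 2 * c1 ^+ 2) + th ^+ 2 * c1 ^+ 3) by ring.
lra.
Qed.

(* In the determinant of [h], [B h], [B^2 h] the last two columns can be made to
   depend on the projection of [h] only, because [X] is an eigenvector of [B]. *)
Lemma dual_forms_bound : exists2 c : R, 0 < c & forall h : 'cV[int]_3, h != 0 ->
  c <= enorm (imx h) * dot (projP X (imx h)) (projP X (imx h)).
Proof.
have [c1 c10 h1] := mulmx_entry_bound (imx B - theta%:M).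
have [c2 c20 h2] := mulmx_entry_bound (imx B *m imx B - (theta ^+ 2)%:M).
have T0 : 0 < 6 * ((1 + c1) * (1 + c2)) by rewrite !mulr_gt0 //; lra.
exists (6 * ((1 + c1) * (1 + c2)))^-1; first by rewrite invr_gt0.
move=> h h0; rewrite -[leLHS]mul1r ler_pdivrMr //.
have := krylov_det_ge1 irrB h0 => /le_trans -> //.
set u := imx h; set p := projP X u.
have eB (q : 'cV[R]_3) (t : R) : q = u - t *: X ->
    (imx B - theta%:M) *m q = imx B *m u - theta *: u.
  move=> ->; rewrite mulmxBl mulmxBr mul_scalar_mx -scalemxAr eigB.
  by apply/colP => k; rewrite !mxE; ring.
have eB2 (q : 'cV[R]_3) (t : R) : q = u - t *: X ->
    (imx B *m imx B - (theta ^+ 2)%:M) *m q = imx B *m (imx B *m u) - theta ^+ 2 *: u.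
  move=> ->; rewrite mulmxBl mulmxBr mul_scalar_mx -scalemxAr -!mulmxA eigB -scalemxAr eigB.
  by apply/colP => k; rewrite !mxE; ring.
have -> : det3 u (imx B *m u) (imx B *m (imx B *m u)) =
    det3 u ((imx B - theta%:M) *m p) ((imx B *m imx B - (theta ^+ 2)%:M) *m p).
  rewrite (eB p _ erefl) (eB2 p _ erefl).
  move: (imx B *m u) (imx B *m (imx B *m u)) => v t.
  by rewrite /det3 !mxE; ring.
have pm := entry_le_enorm p; have um := entry_le_enorm u.
apply: le_trans (det3_bound um (h1 _ _ pm) (h2 _ _ pm)) _.
rewrite -enorm_sqr -/p; have := enorm_ge0 u; have := enorm_ge0 p.
move: (enorm u) (enorm p) => a b b0 a0.
have : 0 <= a * b ^+ 2 by rewrite mulr_ge0 ?sqr_ge0.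
have : 0 <= a * b ^+ 2 * c1 by rewrite !mulr_ge0 ?sqr_ge0.
have : 0 <= a * b ^+ 2 * c2 by rewrite !mulr_ge0 ?sqr_ge0.
lra.
Qed.

End BadApproximation.

(** * Balanced states and loops *)

(** Pigeonhole principle: infinitely many indices satisfy [S], while only finitely many integer
    matrices have entries bounded by [K]. *)
Lemma bounded_mx_repeats (R : realType) (S : nat -> Prop) (f : nat -> 'M[int]_3) (K : R) :
  (forall N, exists2 s, (N <= s)%N & S s) ->
  (forall s, S s -> forall i j, `|(f s i j)%:~R| <= K) ->
  exists s p, [/\ (0 < p)%N, S s, S (s + p)%N & f (s + p)%N = f s].
Proof.
move=> inf bnd.
pose k := Num.truncn K.
have kK s : S s -> forall i j, (`|f s i j| <= k)%N.
  move=> Ss i j; rewrite /k truncn_ge_nat; last by apply: le_trans (bnd _ Ss i j).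
  by apply: le_trans (bnd _ Ss i j); rewrite -intr_norm -abszE.
have inf' N : exists s, (N <= s)%N /\ S s by have [s] := inf N; exists s.
have [g hg] := choice inf'.
(* A strictly increasing sequence of indices in [S]. *)
pose t m := iter m (fun x => g x.+1) (g 0%N).
have St m : S (t m) by case: m => [|m]; rewrite /t /=; apply: (hg _).2.
have tlt m : (t m < t m.+1)%N by rewrite /t /=; apply: (hg _).1.
have tmono : {homo t : m m' / (m < m')%N} by apply: homo_ltn => //; apply: ltn_trans.
(* Entries lie between [- k] and [k]; a shift by [k] makes them ordinals below [k + k + 1]. *)
pose T := {ffun 'I_3 * 'I_3 -> 'I_(k + k).+1}.
pose phi (m : 'I_#|{: T}|.+1) : T :=
  [ffun ij => inord (absz (f (t m) ij.1 ij.2 + k%:Z))].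
have phi_f m m' : phi m = phi m' -> f (t m) = f (t m').
  move=> e; apply/matrixP => i j; have /ffunP/(_ (i, j)) := e; rewrite !ffunE /=.
  have := kK _ (St m) i j; have := kK _ (St m') i j.
  move: (f (t m) i j) (f (t m') i j) => x y hy hx /(congr1 (@nat_of_ord _)).
  by rewrite !inordK; lia.
have : ~~ injectiveb phi.
  by apply/negP => /injectiveP/leq_card; rewrite card_ord ltnn.
case/injectivePn => m [m' mm' /phi_f e].
wlog lt : m m' mm' e / (m < m')%N.
  move=> W; have [|] := ltnP m m'; first exact: W.
  rewrite leq_eqVlt => /orP[/eqP h|]; last by apply: W; rewrite // eq_sym.
  by case/eqP: mm'; apply: val_inj.
exists (t m), (t m' - t m)%N; have lt' := tmono _ _ lt.
by rewrite subnKC ?subn_gt0 // ltnW.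
Qed.

(** * The dual basis of the columns *)

Section Dual.
Variables (R : realType) (X : 'cV[R]_3).
Hypothesis X0 : X != 0.

Definition dual_vec (F : 'M[int]_3) (c : 'I_3) : 'cV[int]_3 := (row c (invmx F))^T.
Local Notation dualr F c := (map_mx (intr : int -> R) (dual_vec F c)).

Lemma dot_dual F c k : F \in unitmx -> dot (dualr F c) (rcol R F k) = (c == k)%:R.
Proof.
move=> uF; have /matrixP/(_ c k) := mulVmx uF; rewrite !mxE.
move/(congr1 (intr : int -> R)); rewrite rmorph_sum /= => e.
rewrite -[RHS]mulrz_nat -[RHS]/((_ == _)%:R%:~R) -e.
by apply: eq_bigr => i _; rewrite !mxE rmorphM.
Qed.

Lemma dual_neq0 F c : F \in unitmx -> dual_vec F c != 0.
Proof.
move=> uF; apply/eqP => h; have := dot_dual c c uF; rewrite h eqxx map_mx0.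
rewrite dotE !mxE !mul0r !addr0 => /esym/eqP; by rewrite oner_eq0.
Qed.

(** Both sides have the same inner products with all columns, since the determinant is a sign, and
    the columns form a basis. *)
Lemma dual_cross F a b c : F \in unitmx -> distinct3 a b c ->
  dualr F c = det3 (rcol R F a) (rcol R F b) (rcol R F c) *: cross (rcol R F a) (rcol R F b).
Proof.
move=> uF d; apply/eqP; rewrite -subr_eq0; apply/eqP; set dl := _ - _.
have dlk k : dot dl (rcol R F k) = 0.
  rewrite dotBl dotZl dot_cross dot_dual //.
  have := det3_distinct R uF d; case/and3P: (d) => ab bc ac.
  have [->|->|->] := distinct3_cases k d.
  - have -> : det3 (rcol R F a) (rcol R F b) (rcol R F a) = 0 by rewrite /det3; ring.
    by rewrite mulr0 subr0 eq_sym (negPf ac).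
  - have -> : det3 (rcol R F a) (rcol R F b) (rcol R F b) = 0 by rewrite /det3; ring.
    by rewrite mulr0 subr0 eq_sym (negPf bc).
  - by rewrite eqxx expr2 => ->; rewrite subrr.
have : dl^T *m map_mx intr F = 0.
  apply/rowP => k; rewrite [RHS]mxE -[RHS](dlk k) mxE.
  by apply: eq_bigr => i _; rewrite rcolE !mxE.
move/(congr1 (mulmx^~ (map_mx intr (invmx F)))).
rewrite -mulmxA -map_mxM mulmxV // map_mx1 mulmx1 mul0mx => /(congr1 trmx).
by rewrite trmxK trmx0.
Qed.

(** With [r] for the projections and [x] for the values, the right side is the squared length of
    [x_b r_a - x_a r_b]. *)
Lemma dual_proj F a b c : F \in unitmx -> distinct3 a b c ->
  dot X X * dot (projP X (dualr F c)) (projP X (dualr F c)) =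
  dot (rproj X F a) (rproj X F a) * xval X F b ^+ 2 +
  dot (rproj X F b) (rproj X F b) * xval X F a ^+ 2 -
  2 * (dot (rproj X F a) (rproj X F b) * (xval X F a * xval X F b)).
Proof.
move=> uF d; have n0 : dot X X != 0 by rewrite dot_eq0.
rewrite /rproj !dot_projP // (dual_cross uF d) !(dotZl, dotZr) cross_sqr !dot_cross.
have := det3_distinct R uF d; set D := det3 _ _ (rcol R F c) => D2.
have -> : D * (D * (dot (rcol R F a) (rcol R F a) * dot (rcol R F b) (rcol R F b)
   - dot (rcol R F a) (rcol R F b) ^+ 2)) -
   D * det3 (rcol R F a) (rcol R F b) X * (D * det3 (rcol R F a) (rcol R F b) X) / dot X X
   = D ^+ 2 * (dot (rcol R F a) (rcol R F a) * dot (rcol R F b) (rcol R F b)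
   - dot (rcol R F a) (rcol R F b) ^+ 2 - det3 (rcol R F a) (rcol R F b) X ^+ 2 / dot X X).
  by field.
rewrite D2 mul1r det3_sqr /xval; field.
by [].
Qed.

Lemma dual_proj_le F a b c : F \in unitmx -> distinct3 a b c ->
  dot X X * dot (projP X (dualr F c)) (projP X (dualr F c)) <=
  2 * (dot (rproj X F a) (rproj X F a) * xval X F b ^+ 2 +
  dot (rproj X F b) (rproj X F b) * xval X F a ^+ 2).
Proof.
move=> uF d; rewrite (dual_proj uF d).
move: (rproj X F a) (rproj X F b) (xval X F a) (xval X F b) => u v x y.
have := dot_ge0 (y *: u + x *: v).
rewrite !(dotDl, dotDr, dotZl, dotZr) (dotC v u); lra.
Qed.

Lemma dual_weight F w c : state X F w -> dot (dualr F c) X = w c.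
Proof.
move=> [uF eX _ _].
have [a ca] : exists a : 'I_3, c != a.
  by case: (eqVneq c 0) => [->|]; [exists 1 | exists 0].
have [b d] := third_index ca.
rewrite eX (sum_distinct3 _ d) !dotDr !dotZr !dot_dual // eqxx.
by case/and3P: d => /negPf -> _ /negPf ->; rewrite mulr1 !mulr0 !addr0.
Qed.

Lemma weight_sum F w : state X F w -> \sum_k w k * xval X F k = dot X X.
Proof.
move=> [uF eX _ _]; have d : distinct3 0 1 2 by [].
rewrite (sum_distinct3 _ d) {4}eX (sum_distinct3 _ d) !dotDl !dotZl.
by [].
Qed.

End Dual.

(** * Boundedness after drops of the smallest cofactor *)

Section Balanced.
Variables (R : realType) (X : 'cV[R]_3) (G : nat -> 'M[int]_3).
Hypothesis ratX : rat_independent X.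
Hypothesis posX : pos_increasing X.
Hypothesis runG : sva_run X G.
Variables (B : 'M[int]_3) (theta : R).
Hypothesis eigB : map_mx intr B *m X = theta *: X.
Hypothesis irrB : irreducible_poly (char_poly (map_mx intr B : 'M[rat]_3)).
Local Notation imx := (map_mx (intr : int -> R)).
Local Notation x s k := (xval X (G s) k).
Local Notation rr s k := (dot (rproj X (G s) k) (rproj X (G s) k)).
Local Notation n := (dot X X).
Local Notation xb := (\sum_k X k 0).

Let X0 : X != 0 := X_neq0 posX.
Let n0 : 0 < n := normX_gt0 posX.
Let e0 : 0 < enorm X := enormX_gt0 posX.
Let x_gt0 s k : 0 < x s k := run_xval_gt0 ratX posX runG s k.
Let X2 : 0 < X 2 0.
Proof. by case: posX => *; lra. Qed.

Lemma run_sorted s : x s 0 < x s 1 /\ x s 1 < x s 2.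
Proof. by have [w []] := run_state ratX posX runG s. Qed.

Lemma run_xval_ge s k : x s 0 <= x s k.
Proof.
have [s01 s12] := run_sorted s.
by have [->|->|->] := @distinct3_cases 0 1 2 k isT; lra.
Qed.

Lemma run_xval_le2 s k : x s k <= x s 2.
Proof.
have [s01 s12] := run_sorted s.
by have [->|->|->] := @distinct3_cases 0 1 2 k isT; lra.
Qed.

Lemma run_xval_le s k : x s k <= xb.
Proof.
have h : x s k <= \sum_k x s k.
  rewrite (bigD1 k) //= lerDl; apply: sumr_ge0 => i _; exact: ltW.
apply: le_trans h _.
have -> : xb = \sum_k x 0 k by apply: eq_bigr => i _; have [-> _] := runG; rewrite xval1.
case: s => // s; apply: ltW.
exact: (run_sum_decreasing ratX posX runG 0 (ltn0Sn s)).
Qed.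

Let xb0 : 0 < xb := lt_le_trans (x_gt0 0 0) (run_xval_le 0 0).

Lemma run_rcol_sqr s k : dot (rcol R (G s) k) (rcol R (G s) k) = rr s k + x s k ^+ 2 / n.
Proof. by rewrite /rproj dot_projP // expr2 subrK. Qed.

(** Fatness bounds the squared lengths by the total area, and the smallest cofactor times the total
    area is at most [(\sum_k w k * x s k) / enorm X = enorm X]. *)
Lemma run_proj_bound : exists2 K : R, 0 < K & forall s k, x s 0 * rr s k <= K.
Proof.
exists (4 * (200 * enorm X + start_bound X * xb) + 1).
  have := start_bound_ge0 X => c0.
  have : 0 <= start_bound X * xb by rewrite mulr_ge0 // ltW.
  have := e0; lra.
move=> s k; have [w [st so ft]] := run_state ratX posX runG s.
have := fat_bound k (state_planar X0 st) (start_bound_ge0 X) ft.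
rewrite -(ler_pM2l (x_gt0 s 0)) => /le_trans; apply.
have h1 : x s 0 * \sum_k area X w k <= enorm X.
  have -> : enorm X = (\sum_k w k * x s k) / enorm X.
    rewrite (weight_sum st) -[in RHS]enorm_sqr expr2 mulfK //; exact: lt0r_neq0.
  rewrite mulr_sumr mulr_suml; apply: ler_sum => i _.
  rewrite /area mulrCA mulrA ler_pM2r ?invr_gt0 // ler_pM2l ?run_xval_ge //.
  by case: st.
have h2 : x s 0 * start_bound X <= xb * start_bound X.
  by rewrite ler_wpM2r ?start_bound_ge0 ?run_xval_le.
rewrite /area_bound; lra.
Qed.

Definition drop s : Prop := x s.+1 0 < x s 0.

(** The new smallest value is the difference just formed. The old smallest column is not the
    modified one, so its value survives at a later position. *)
Lemma drop_witness s : drop s -> x s.+1 1 <= x s 0 /\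
  exists j i, rproj X (G s.+1) 0 = rproj X (G s) j - rproj X (G s) i.
Proof.
move=> dr; have [j [i [sg [ij xij _ e]]]] := run_step ratX posX runG s.
have xE k : x s.+1 k = if sg k == j then x s j - x s i else x s (sg k).
  by rewrite e /xval rcol_perm; apply: xval_sub.
have sg0 : sg 0 = j.
  apply/eqP; apply: contraLR dr; rewrite /drop xE => /negPf ->.
  by rewrite -leNgt run_xval_ge.
have j0 : j != 0.
  by apply/eqP => j0; move: xij; rewrite j0 ltNge run_xval_ge.
split; last first.
  by exists j, i; rewrite e /rproj rcol_perm -/(rproj _ _ _) rproj_sub /sub_vec sg0 eqxx.
have k0 : (sg^-1)%g 0 != 0.
  by apply: contra j0 => /eqP h; rewrite -sg0 -{1}h permKV.
have := xE ((sg^-1)%g 0); rewrite permKV eq_sym (negPf j0) => <-.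
have [s01 s12] := run_sorted s.+1.
by have [h|h|h] := @distinct3_cases 0 1 2 ((sg^-1)%g 0) isT;
  rewrite h in k0 *; [case/eqP: k0 | lra | lra].
Qed.

(** The new first column is a difference of old ones, so its squared length is [O(1 / x s 0)]. By
    [small_forms_bound] its value is then at least a constant times [x s 0], which bounds [x s.+1 1]
    from above. *)
Lemma drop_ratio : exists2 K : R, 0 < K & forall s, drop s -> x s.+1 1 <= K * x s.+1 0.
Proof.
have [K1 K10 hK] := run_proj_bound.
have [c c0 hc] := small_forms_bound X2 eigB irrB.
exists ((4 * K1 + xb ^+ 3 / n) / c).
  rewrite divr_gt0 // addr_gt0 ?mulr_gt0 // ?invr_gt0 ?exprn_gt0 //.
move=> s /drop_witness[h1 [j [i er]]].
apply: le_trans h1 _; rewrite mulrAC ler_pdivlMr // mulrC.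
pose g := col 0 (G s.+1).
have g0 : g != 0.
  apply/eqP => g0; have := x_gt0 s.+1 0; rewrite /xval /rcol -/g g0 map_mx0.
  by rewrite dotE !mxE !mul0r !addr0 ltxx.
have := hc g g0; rewrite -/(rcol R (G s.+1) 0) -/(x s.+1 0) run_rcol_sqr.
rewrite (gtr0_norm (x_gt0 _ _)) => h2.
have h3 : x s 0 * rr s.+1 0 <= 4 * K1.
  rewrite er; have := dot_sqrB_le (rproj X (G s) j) (rproj X (G s) i).
  rewrite -(ler_pM2l (x_gt0 s 0)); have := hK s j; have := hK s i; lra.
have h4 : x s 0 * (x s.+1 0 ^+ 2 / n) <= xb ^+ 3 / n.
  rewrite mulrA ler_pM2r ?invr_gt0 // exprS.
  apply: ler_pM; [exact: ltW | exact: sqr_ge0 | exact: run_xval_le |].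
  exact: sqr_le (ltW (x_gt0 _ _)) (run_xval_le _ _).
apply: (@le_trans _ _ (x s.+1 0 * (x s 0 * (rr s.+1 0 + x s.+1 0 ^+ 2 / n)))).
  rewrite mulrCA [leLHS]mulrC; exact: (ler_wpM2l (ltW (x_gt0 s 0)) h2).
rewrite [leRHS]mulrC; apply: ler_wpM2l; first exact: ltW.
rewrite mulrDr; lra.
Qed.

(* At a drop the two smallest values are comparable, so the dual vector of the
   third column is close to the line of [X]; not too close by
   [dual_forms_bound], and this bounds the largest value. *)
Lemma drop_balanced : exists2 K : R, 0 < K & forall s, drop s ->
  forall k, x s.+1 2 * rr s.+1 k <= K.
Proof.
have [K1 K10 hK1] := run_proj_bound.
have [K2 K20 hK2] := drop_ratio.
have [c c0 hc] := dual_forms_bound eigB irrB.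
pose E := 8 * K1 * K2 ^+ 2 / n.
have E0 : 0 < E by rewrite /E divr_gt0 // !mulr_gt0 ?exprn_gt0.
have [K3 [K30 eK3]] : exists K3, 0 < K3 /\ K3 = (xb + E * xb ^+ 2 + enorm X) * E / c.
  eexists; split; last reflexivity.
  by rewrite divr_gt0 // mulr_gt0 // !addr_gt0 // mulr_gt0 // exprn_gt0.
exists (K3 * K1); first exact: mulr_gt0.
(* By [run_proj_bound] it suffices that the largest value is comparable with the smallest. *)
move=> s dr k; suff h : x s.+1 2 <= K3 * x s.+1 0.
  apply: (@le_trans _ _ (K3 * x s.+1 0 * rr s.+1 k)).
    by rewrite ler_wpM2r ?dot_ge0.
  by rewrite -mulrA ler_pM2l.
have {hK2}h21 := hK2 _ dr; move: (s.+1) h21 => m h21 {s dr}.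
have [w [st so _]] := run_state ratX posX runG m.
have uG := run_unit ratX posX runG m.
set h := dual_vec (G m) 2; have h0 : h != 0 by exact: dual_neq0 R _ _ uG.
have := hc h h0; set H := dot (projP X (imx h)) (projP X (imx h)).
have H0 : 0 <= H by exact: dot_ge0.
have w0 : 0 < w 2 by case: st.
pose z := w 2 / enorm X.
have z0 : 0 <= z by rewrite ltW // divr_gt0.
have zz : z ^+ 2 = w 2 ^+ 2 / n by rewrite /z expr_div_n enorm_sqr.
have hh : enorm (imx h) <= 1 + H + z.
  apply: le_of_sqr; first lra.
  have -> : enorm (imx h) ^+ 2 = H + z ^+ 2.
    by rewrite enorm_sqr /H dot_projP // (dual_weight _ st) zz expr2 subrK.
  have : 0 <= H * z by rewrite mulr_ge0.
  nra.
(* By [dual_proj_le] and [x m 1 = O(x m 0)], [H] is bounded by squared lengths times [x m 0 ^+ 2],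
   and one factor [x m 0] absorbs the lengths. *)
have HE : H <= E * x m 0.
  rewrite /E mulrAC ler_pdivlMr // mulrC.
  apply: le_trans (dual_proj_le X0 uG (isT : distinct3 0 1 2)) _.
  have x1 : x m 1 ^+ 2 <= K2 ^+ 2 * x m 0 ^+ 2.
    by rewrite -exprMn; apply: sqr_le => //; exact: ltW.
  have x01 : x m 0 ^+ 2 <= x m 1 ^+ 2.
    exact: sqr_le (ltW (x_gt0 _ _)) (run_xval_ge _ _).
  have r0 := dot_ge0 (rproj X (G m) 0); have r1 := dot_ge0 (rproj X (G m) 1).
  have a0 := hK1 m 0; have a1 := hK1 m 1.
  have b0 : rr m 0 * x m 1 ^+ 2 <= K1 * (K2 ^+ 2 * x m 0).
    apply: (@le_trans _ _ (rr m 0 * (K2 ^+ 2 * x m 0 ^+ 2))); first exact: ler_wpM2l.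
    have -> : rr m 0 * (K2 ^+ 2 * x m 0 ^+ 2) = (x m 0 * rr m 0) * (K2 ^+ 2 * x m 0) by ring.
    by rewrite ler_wpM2r // mulr_ge0 ?sqr_ge0 ?ltW.
  have b1 : rr m 1 * x m 0 ^+ 2 <= K1 * (K2 ^+ 2 * x m 0).
    apply: (@le_trans _ _ (rr m 1 * (K2 ^+ 2 * x m 0 ^+ 2))).
      by apply: ler_wpM2l => //; apply: le_trans x1.
    have -> : rr m 1 * (K2 ^+ 2 * x m 0 ^+ 2) = (x m 0 * rr m 1) * (K2 ^+ 2 * x m 0) by ring.
    by rewrite ler_wpM2r // mulr_ge0 ?sqr_ge0 ?ltW.
  have -> : 8 * K1 * K2 ^+ 2 * x m 0 = 8 * (K1 * (K2 ^+ 2 * x m 0)) by ring.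
  have : 0 <= K1 * (K2 ^+ 2 * x m 0).
    by rewrite !mulr_ge0 ?sqr_ge0 // ltW.
  lra.
have xz : x m 2 * z <= enorm X.
  rewrite /z mulrA ler_pdivrMr // -expr2 enorm_sqr -(weight_sum st).
  rewrite (bigD1 2) //= [x m 2 * _]mulrC lerDl; apply: sumr_ge0 => i _.
  by rewrite mulr_ge0 ?ltW //; case: st.
move=> hcH; rewrite eK3 mulrAC ler_pdivlMr //.
(* Multiplied by [x m 2], this bounds [c * x m 2] by a constant times [x m 0], because [x m 2 * z]
   is bounded. *)
have s1 : c <= (1 + E * xb + z) * (E * x m 0).
  apply: le_trans hcH _; apply: ler_pM => //; first exact: enorm_ge0.
  apply: le_trans hh _; rewrite lerD2r lerD2l; apply: le_trans HE _.
  by rewrite ler_pM2l // run_xval_le.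
apply: (@le_trans _ _ (x m 2 * ((1 + E * xb + z) * (E * x m 0)))).
  by rewrite ler_pM2l.
rewrite [x m 2 * _]mulrA -[leRHS]mulrA; apply: ler_wpM2r.
  by rewrite mulr_ge0 ?ltW.
have s2 := run_xval_le m 2.
have : E * xb * x m 2 <= E * xb * xb by rewrite ler_wpM2l // mulr_ge0 ?ltW.
by rewrite expr2; lra.
Qed.

(** Without further drops the smallest value stays away from 0, so [run_proj_bound] bounds all
    columns and some matrix recurs, although the sum of the cofactors strictly decreases. *)
Lemma drop_infinite N : exists2 s, (N <= s)%N & drop s.
Proof.
apply: contrapT => nd.
have nd' s : (N <= s)%N -> x s 0 <= x s.+1 0.
  by move=> Ns; rewrite leNgt; apply/negP => dr; apply: nd; exists s.
have xN p : x N 0 <= x (N + p)%N 0.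
  elim: p => [|p IH]; first by rewrite addn0.
  by rewrite addnS; apply: le_trans IH (nd' _ (leq_addr _ _)).
have [K1 K10 hK1] := run_proj_bound.
have bnd s : (N <= s)%N -> forall i j, `|(G s i j)%:~R| <= 1 + (K1 / x N 0 + xb ^+ 2 / n).
  move=> Ns i j; have := entry_le_enorm (rcol R (G s) j) i; rewrite rcolE.
  move/le_trans; apply.
  have h1 : rr s j <= K1 / x N 0.
    rewrite ler_pdivlMr // mulrC; apply: le_trans (hK1 s j).
    by rewrite ler_wpM2r ?dot_ge0 //; have := xN (s - N)%N; rewrite subnKC.
  have h2 : x s j ^+ 2 / n <= xb ^+ 2 / n.
    rewrite ler_pM2r ?invr_gt0 //; exact: sqr_le (ltW (x_gt0 _ _)) (run_xval_le _ _).
  have h3 : enorm (rcol R (G s) j) ^+ 2 = rr s j + x s j ^+ 2 / n.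
    by rewrite enorm_sqr run_rcol_sqr.
  move: (enorm _) h3 => q h3; have : 0 <= (q - 1) ^+ 2 by exact: sqr_ge0.
  have : 0 <= q ^+ 2 by exact: sqr_ge0.
  nra.
have [|s [p [p0 Ns _ e]]] := bounded_mx_repeats (S := fun s => (N <= s)%N) _ bnd.
  by move=> M; exists (maxn N M); rewrite ?leq_maxl ?leq_maxr.
have := run_sum_decreasing ratX posX runG s p0.
by rewrite e ltxx.
Qed.

(* Integer matrices with the eigenvector [xvec X (G s)] for the eigenvalue
   [theta]; equality of two of them forces a loop. *)
Definition conj_matrix s : 'M[int]_3 := (G s)^T *m B *m (invmx (G s))^T.

Lemma conj_matrixE s k l : (conj_matrix s k l)%:~R =
  dot (rcol R (G s) k) (imx B *m imx (dual_vec (G s) l)).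
Proof.
have -> : (conj_matrix s k l)%:~R = (imx (conj_matrix s)) k l by rewrite [RHS]mxE.
rewrite /conj_matrix -mulmxA map_mxM mxE; apply: eq_bigr => i _.
rewrite rcolE !mxE; congr (_ * _); rewrite rmorph_sum /=.
by apply: eq_bigr => j _; rewrite !mxE rmorphM.
Qed.

(** The dual vector is split along [X]. Its projection has squared length [O(x m 2)], while that of
    the column is [O(1 / x m 2)]. The part along [X] contributes an area times a cofactor, at most
    [x m 2] times a product of two projected lengths. *)
Lemma conj_matrix_bounded : exists K : R, forall s, drop s -> forall k l,
  `|(conj_matrix s.+1 k l)%:~R| <= K.
Proof.
have [K3 K30 hK3] := drop_balanced.
have [cB cB0 hB] := mulmx_entry_bound (imx B).
have [T eT] : exists T, T = 4 * K3 * (K3 + xb ^+ 3 / n) / n by eexists.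
exists (3 * cB * (1 + T) + K3 * `|theta| / enorm X).
move=> s /hK3; move: (s.+1) => m hm k l; rewrite conj_matrixE.
have [w [st so _]] := run_state ratX posX runG m.
have uG := run_unit ratX posX runG m.
set h := imx (dual_vec (G m) l); set g := rcol R (G m) k.
have [a la] : exists a : 'I_3, l != a.
  by case: (eqVneq l 0) => [->|]; [exists 1 | exists 0].
have [b d0] := third_index la.
have d : distinct3 a b l := distinct3_rot d0.
have hE : h = projP X h + (w l / n) *: X.
  by rewrite /projP /projD (dual_weight _ st) subrK.
have -> : dot g (imx B *m h) = dot g (imx B *m projP X h) + w l / n * theta * x m k.
  rewrite {1}hE mulmxDr -scalemxAr eigB dotDr !dotZr mulrA; congr (_ + _).
apply: le_trans (ler_normD _ _) _; apply: lerD.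
  apply: le_trans (dot_entry_bound (entry_le_enorm g) (hB _ _ (entry_le_enorm (projP X h)))) _.
  rewrite -!mulrA ler_pM2l ?ltr0n // mulrCA; apply: ler_wpM2l => //.
  have sq : (enorm g * enorm (projP X h)) ^+ 2 <= T.
    rewrite eT exprMn !enorm_sqr run_rcol_sqr ler_pdivlMr // -[leLHS]mulrA
      [dot (projP _ _) _ * n]mulrC.
    have hy (i j : 'I_3) : rr m i * x m j ^+ 2 <= K3 * x m 2.
      have : rr m i * x m j ^+ 2 <= rr m i * (x m 2 * x m 2).
        rewrite ler_wpM2l ?dot_ge0 // -expr2.
        exact: sqr_le (ltW (x_gt0 _ _)) (run_xval_le2 _ _).
      move/le_trans; apply; rewrite mulrA [rr m i * _]mulrC.
      by rewrite ler_pM2r.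
    have nH := dual_proj_le X0 uG d; rewrite -/h in nH.
    have h1 := hy a b; have h2 := hy b a.
    have nH' : n * dot (projP X h) (projP X h) <= 4 * K3 * x m 2 by lra.
    apply: (@le_trans _ _ ((rr m k + x m k ^+ 2 / n) * (4 * K3 * x m 2))).
      rewrite ler_wpM2l // addr_ge0 ?dot_ge0 // divr_ge0 ?sqr_ge0 ?ltW //.
    have p1 : rr m k * x m 2 <= K3 by rewrite mulrC.
    have p2 : x m k ^+ 2 / n * x m 2 <= xb ^+ 3 / n.
      rewrite mulrAC ler_pM2r ?invr_gt0 // [xb ^+ 3]exprSr.
      apply: ler_pM; [exact: sqr_ge0 | exact: ltW | | exact: run_xval_le].
      exact: sqr_le (ltW (x_gt0 _ _)) (run_xval_le _ _).
    have -> : (rr m k + x m k ^+ 2 / n) * (4 * K3 * x m 2) =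
      4 * K3 * (rr m k * x m 2 + x m k ^+ 2 / n * x m 2) by ring.
    by rewrite ler_pM2l ?mulr_gt0 //; exact: lerD.
  move: (enorm g * _) sq => q sq.
  have : 0 <= (q - 1) ^+ 2 by exact: sqr_ge0.
  have : 0 <= q ^+ 2 by exact: sqr_ge0.
  nra.
have [al eal _] := state_planar X0 st d.
have wl : 0 < w l by case: st.
rewrite -[in w l / n]enorm_sqr.
have -> : `|w l / enorm X ^+ 2 * theta * x m k| = (x m k * area X w l) * `|theta| / enorm X.
  rewrite !normrM normfV (gtr0_norm wl) (gtr0_norm (x_gt0 _ _)) normrX (gtr0_norm e0).
  by rewrite /area; field; apply: lt0r_neq0.
rewrite ler_pM2r ?invr_gt0 //; apply: ler_wpM2r => //.
apply: le_of_sqr; first exact: ltW.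
apply: (@le_trans _ _ ((x m 2 * rr m a) * (x m 2 * rr m b))); last first.
  by rewrite expr2; apply: ler_pM => //; rewrite mulr_ge0 ?dot_ge0 ?ltW.
have -> : x m 2 * rr m a * (x m 2 * rr m b) = x m 2 ^+ 2 * (rr m a * rr m b) by ring.
rewrite exprMn; apply: ler_pM; rewrite ?sqr_ge0 //.
  exact: sqr_le (ltW (x_gt0 _ _)) (run_xval_le2 _ _).
by rewrite eal lerDr sqr_ge0.
Qed.

Lemma conj_matrix_eigen s :
  map_mx ratr (map_mx (intr : int -> rat) (conj_matrix s)) *m xvec X (G s) =
  theta *: xvec X (G s).
Proof.
have -> : map_mx ratr (map_mx (intr : int -> rat) (conj_matrix s)) = imx (conj_matrix s).
  by apply/matrixP => i j; rewrite !mxE ratr_int.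
have uG := run_unit ratX posX runG s.
rewrite /xvec /conj_matrix !map_mxM map_trmx -!mulmxA.
rewrite [imx (invmx _)^T *m _]mulmxA -map_mxM -trmx_mul mulmxV // trmx1 map_mx1 mul1mx.
by rewrite eigB -scalemxAr.
Qed.

(** Two equal conjugates of [B] share the eigenvalue [theta], so by [eigen_powers] their
    eigenvectors, the two cofactor vectors, are proportional; the first entries give the factor. *)
Lemma run_loops : exists s p lambda, (0 < p)%N /\
  cofactor_vec X G (s + p) = lambda *: cofactor_vec X G s.
Proof.
have [K hK] := conj_matrix_bounded.
have [s [p [p0 _ _ e]]] :=
  bounded_mx_repeats (f := fun s => conj_matrix s.+1) drop_infinite hK.
exists s.+1, p, (x (s.+1 + p)%N 0 / x s.+1 0); split => //.
rewrite !(cofactor_xvec ratX posX runG).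
have e1 := conj_matrix_eigen s.+1.
have e2 := conj_matrix_eigen (s.+1 + p)%N; rewrite addSn e in e2.
pose N := map_mx (intr : int -> rat) (conj_matrix s.+1).
have uG := run_unit ratX posX runG s.+1.
pose V := map_mx (intr : int -> rat) (G s.+1)^T.
have VV : V *m map_mx intr (invmx (G s.+1))^T = 1%:M.
  by rewrite -map_mxM -trmx_mul mulVmx // trmx1 map_mx1.
have uV : V \in unitmx by case: (mulmx1_unit VV).
(* [N] is conjugate to [B] over the rationals, so the irreducible polynomial of [B] annihilates
   it. *)
have N0 : horner_mx N (char_poly (map_mx intr B : 'M[rat]_3)) = 0.
  rewrite /N /conj_matrix !map_mxM -/V -[map_mx _ (invmx _)^T](mulKmx uV) VV mulmx1.
  by rewrite horner_mx_uconj // Cayley_Hamilton mulmx0 mul0mx.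
pose u : 'rV[rat]_3 := delta_mx 0 0.
have uK : krylov u N \in unitmx.
  apply: (krylov_unit irrB _ N0); first by rewrite size_char_poly.
  by apply/eqP => /rowP/(_ 0)/eqP; rewrite !mxE eqxx oner_eq0.
have uX (Y : 'cV[R]_3) : (map_mx ratr u *m Y) 0 0 = Y 0 0.
  by rewrite map_delta_mx -rowE mxE.
have := eigen_powers uK e1; have := eigen_powers uK e2.
rewrite !uX !xvecE addSn => h2 h1; rewrite h2 {1}h1 scalerA divfK //.
exact: lt0r_neq0.
Qed.

End Balanced.

(** * Assembly of the two directions *)

Lemma size_monic_cubic (F : fieldType) (a b c : F) :
  size ('X^3 - a *: 'X^2 - b *: 'X - c%:P : {poly F}) = 4.
Proof.
rewrite -!addrA size_polyDl size_polyXn // ltnS.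
rewrite -!opprD size_polyN addrA.
apply: leq_trans (size_polyD _ _) _; rewrite geq_max.
rewrite (leq_trans (size_polyC_leq1 c)) // andbT.
apply: leq_trans (size_polyD _ _) _; rewrite geq_max.
rewrite (leq_trans (size_scale_leq _ _)) ?size_polyXn //=.
by rewrite (leq_trans (size_scale_leq _ _)) // size_polyX.
Qed.

Theorem theorem1 (R : realType) :
  (forall (a b c : rat) (rho : R) (X : 'cV[R]_3) (G : nat -> 'M[int]_3),
      let P : {poly rat} := 'X^3 - a *: 'X^2 - b *: 'X - c%:P in
      irreducible_poly P ->
      qeval P rho = 0 ->
      (forall i, Qadjoin rho (X i 0)) ->
      rat_independent X ->
      pos_increasing X ->
      sva_run X G ->
      (exists (s p : nat) (lambda : R),
          (0 < p)%N /\
          cofactor_vec X G (s + p) = lambda *: cofactor_vec X G s /\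
          algebraic_integer lambda /\
          algebraic_degree lambda 3 /\
          algebraic_unit lambda /\
          Qadjoin rho = Qadjoin lambda /\
          rational_function_of lambda (X 0 0 / X 2 0) /\
          rational_function_of lambda (X 1 0 / X 2 0)) /\
      (forall s p : nat,
          (exists lambda : R,
              cofactor_vec X G (s + p) = lambda *: cofactor_vec X G s) <->
          cofactor_ratios X G (s + p) = cofactor_ratios X G s)) /\
  (forall (X : 'cV[R]_3) (G : nat -> 'M[int]_3) (s p : nat) (lambda : R),
      rat_independent X ->
      pos_increasing X ->
      sva_run X G ->
      (0 < p)%N ->
      cofactor_vec X G (s + p) = lambda *: cofactor_vec X G s ->
      algebraic_integer lambda /\
      algebraic_degree lambda 3 /\
      algebraic_unit lambda /\
      rational_function_of lambda (X 0 0 / X 2 0) /\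
      rational_function_of lambda (X 1 0 / X 2 0)).
Proof.
split=> [a b c rho X G P irrP rootP adjX ratX posX runG|X G s p lambda ratX posX runG p0 e];
  last first.
  by have [? ? ? _ []] := loop_conclusion ratX posX runG p0 e.
split; last exact: cofactor_proportional.
have sP : size P = 4 by exact: size_monic_cubic.
have [C [uC eX]] := coordinates_powers irrP sP rootP ratX adjX.
have [A eA] := multiplication_matrix irrP sP rootP ratX adjX.
have [B [theta [eB irrB]]] := integer_eigenmatrix irrP sP rootP ratX adjX.
have [s [p [lambda [p0 e]]]] := run_loops ratX posX runG eB irrB.
have [h1 h2 h3 [D [N [uD eXD eN]]] [h4 h5]] := loop_conclusion ratX posX runG p0 e.
have X2 : X 2 0 != 0 by apply: lt0r_neq0; case: posX => *; lra.
exists s, p, lambda; do !split => //.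
rewrite -[_ *m _]scale1r in eX.
(* [X] is a rational combination of powers of [rho] and of [lambda], and both are eigenvalues of
   rational matrices at [X]; so each is a polynomial in the other. *)
by apply/seteqP; split; apply: Qadjoin_sub;
  [apply: eigenvalue_Qadjoin X2 uD eXD eA | apply: eigenvalue_Qadjoin (oner_neq0 _) uC eX eN].
Qed.
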